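(* Let $d\ge 2$, let $N=2n+1$ with $n\ge 1$ an integer, and let $R>0$ and $T\ge \frac{3\sqrt2+1}{4}R$. Let $X$, $K$, $E_k$, $\mathbf 1_N$ and the filtered kernel modes $\hat B_N^\sigma(l,m)$ ($l,m\in K$) be as defined in the context. Let $f^0:\mathbb R^d\to\mathbb R$ be an initial distribution function with $f^0(v)\ge 0$ for all $v\in\mathbb R^d$. Consider the solution $(\hat F_k(t))_{k\in K}$ of the ODE initial value problem (the entropic Fourier method) $$ \frac{d\hat F_k}{dt}=\sum_{l,m\in K}\mathbf 1_N(l+m-k)\left(\hat B_N^\sigma(l,m)-\hat B_N^\sigma(m,m)\right)\hat F_l\,\hat F_m,\qquad k\in K, $$ $$ \hat F_k(0)=\frac1{N^d}\sum_{r\in X} f^0(r)\,E_{-k}(r),\qquad k\in K, $$ and define $F_r(t)=\sum_{k\in K}\hat F_k(t)E_k(r)$ for $r\in X$. Then for all $t>0$: (i) (conservation of mass) $\displaystyle \frac{d}{dt}\sum_{r\in X}F_r(t)=0$; (ii) (non-negativity) $F_r(t)\ge 0$ for every $r\in X$; (iii) (discrete H-theorem) $\displaystyle \frac{d}{dt}\sum_{r\in X}F_r(t)\ln F_r(t)\le 0$.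
   Context: Grids. $N=2n+1$, $h=2T/N$, $\mathcal D_T=[-T,T]^d$, and $$X=\{h k : k=(k_1,\dots,k_d)\in\mathbb Z^d,\ -n\le k_1,\dots,k_d\le n\},\qquad K=\{k=(k_1,\dots,k_d)\in\mathbb Z^d : -n\le k_1,\dots,k_d\le n\}.$$ Fourier modes. $E_k(v)=\exp\left(\frac{\mathrm i\pi}{T}k\cdot v\right)$ for $k\in\mathbb Z^d$, $v\in\mathbb R^d$, where $\mathrm i$ is the imaginary unit. Indicator. For $l\in\mathbb Z^d$, $l\bmod N$ denotes the symmetric componentwise residue, i.e. the representative of $l$ modulo $N$ all of whose components lie in $\{-n,\dots,n\}$. $\mathbf 1_N(l)=1$ if $l\bmod N=0$ (every component of $l$ is divisible by $N$), and $\mathbf 1_N(l)=0$ otherwise. Collision kernel. The collision kernel $\mathcal B$ of the Boltzmann collision operator is non-negative and of the form $$\mathcal B(g,\omega)=b(|g|,\cos\theta),\qquad \cos\theta=\frac{|g\cdot\omega|}{|g|},\qquad g\in\mathbb R^d\setminus\{0\},\ \omega\in\mathbb S^{d-1},$$ for a given function $b\ge 0$. Put $$\tilde{\mathcal B}(y,z)=2^{d-1}\,\mathcal B\left(y+z,\frac{y-z}{|y-z|}\right)|y+z|^{2-d},\qquad y,z\in\mathbb R^d .$$ Kernel modes. With $B_R$ the ball of radius $R$ centered at the origin in $\mathbb R^d$ and $\delta$ the Dirac delta, for $l,m\in\mathbb Z^d$, $$\hat B(l,m)=\int_{B_R}\int_{B_R}\tilde{\mathcal B}(y,z)\,\delta(y\cdot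 z)\,E_l(y)\,E_m(z)\,dy\,dz ,$$ where the Dirac delta is understood in the usual sense, i.e. $\int_{B_R}\int_{B_R}\varphi(y,z)\delta(y\cdot z)\,dy\,dz=\int_{B_R}\frac1{|y|}\int_{\{z\in B_R:\ z\perp y\}}\varphi(y,z)\,dz\,dy$, with the inner integral taken with respect to $(d-1)$-dimensional Lebesgue measure on the hyperplane $y^\perp$. The kernel is assumed to be such that these integrals converge absolutely (so that all $\hat B(l,m)$ are well defined and finite). Set $\hat B_N(l,m)=\hat B(l\bmod N,\,m\bmod N)$. Filter. The one-dimensional modified Jackson filter is, for integers $-n\le\beta\le n$, $$\sigma_N(\beta)=\frac{(n+1-|\beta|)\cos\left(\frac{\pi|\beta|}{n+1}\right)+\sin\left(\frac{\pi|\beta|}{n+1}\right)\cot\left(\frac{\pi}{n+1}\right)}{n+1},$$ and for $k=(k_1,\dots,k_d)\in K$, $\sigma_N(k)=\prod_{i=1}^d\sigma_N(k_i)$. The filtered kernel modes are $$\hat B_N^\sigma(l,m)=\hat B_N(l,m)\,\sigma_N(l)\,\sigma_N(m),\qquad l,m\in K.$$ Convention: $0\ln 0=0$. *)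

(* Defs.v *)
From HB Require Import structures.
From mathcomp Require Import all_boot all_order all_algebra.
From mathcomp Require Import all_classical all_reals all_analysis.
From mathcomp Require Import complex.
Import Order.TTheory GRing.Theory Num.Theory.
Import numFieldNormedType.Exports.

Set Implicit Arguments.
Unset Strict Implicit.
Unset Printing Implicit Defensive.

Local Open Scope classical_set_scope.
Local Open Scope ring_scope.
Local Open Scope complex_scope.

Section LebesgueTuple.
Context {R : realType}.
Local Notation RR := (measurableTypeR R).
Local Notation RT n := (n.-tuple RR).

Definition cons_tuple n (p : RR * RT n) : RT n.+1 := [tuple of p.1 :: p.2].
Definition uncons_tuple n (t : RT n.+1) : RR * RT n :=
  (thead t, [tuple of behead t]).

Lemma cons_tupleK n : cancel (@cons_tuple n) (@uncons_tuple n).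
Proof.
case=> x t; rewrite /uncons_tuple /cons_tuple /= theadE.
by congr pair; exact: val_inj.
Qed.

Lemma measurable_cons_tuple n : measurable_fun [set: RR * RT n] (@cons_tuple n).
Proof. exact: (measurable_cons measurable_fst measurable_snd). Qed.

Lemma measurable_uncons_tuple n :
  measurable_fun [set: RT n.+1] (@uncons_tuple n).
Proof.
apply/measurable_fun_pairP; split; last exact: measurable_behead.
exact: measurable_tnth.
Qed.

Section step.
Variables (n : nat) (mu : {sigma_finite_measure set (RT n) -> \bar R}).

Definition lebesgue_cons : set (RT n.+1) -> \bar R :=
  pushforward (@lebesgue_measure R \x mu)%E (@cons_tuple n).

Let preimage_cons_measurable (A : set (RT n.+1)) :
  measurable A -> measurable (@cons_tuple n @^-1` A).
Proof.
by move=> mA; rewrite -[X in measurable X]setTI; exact: measurable_cons_tuple.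
Qed.

Let lebesgue_cons0 : lebesgue_cons set0 = 0%E.
Proof. by rewrite /lebesgue_cons /pushforward preimage_set0 measure0. Qed.

Let lebesgue_cons_ge0 A : (0 <= lebesgue_cons A)%E.
Proof. by rewrite /lebesgue_cons /pushforward; exact: measure_ge0. Qed.

Let lebesgue_cons_sigma_additive : semi_sigma_additive lebesgue_cons.
Proof.
move=> F mF tF mUF; rewrite /lebesgue_cons /pushforward preimage_bigcup.
apply: measure_semi_sigma_additive.
- by move=> i; exact: preimage_cons_measurable.
- apply/trivIsetP => /= i j _ _ ij; rewrite -preimage_setI.
  by move/trivIsetP : tF => /(_ _ _ _ _ ij) ->//; rewrite preimage_set0.
- by rewrite -preimage_bigcup; exact: preimage_cons_measurable.
Qed.

HB.instance Definition _ := isMeasure.Build _ _ _ lebesgue_cons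
  lebesgue_cons0 lebesgue_cons_ge0 lebesgue_cons_sigma_additive.

Let lebesgue_cons_sigma_finite : sigma_finite setT lebesgue_cons.
Proof.
have /sigma_finiteP[F [TF ndF Foo]] := sigma_finiteT (@lebesgue_measure R).
have /sigma_finiteP[G [TG ndG Goo]] := sigma_finiteT mu.
exists (fun i => @uncons_tuple n @^-1` (F i `*` G i)).
  apply/seteqP; split => // t _.
  have [i _ Fi] : (\bigcup_i F i) (thead t) by rewrite -TF.
  have [j _ Gj] : (\bigcup_i G i) [tuple of behead t] by rewrite -TG.
  exists (maxn i j) => //; split => /=.
    by move: Fi; exact/subsetPset/ndF/leq_maxl.
  by move: Gj; exact/subsetPset/ndG/leq_maxr.
move=> k; have [mF Fk] := Foo k; have [mG Gk] := Goo k; split.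
  rewrite -[X in measurable X]setTI.
  by apply: measurable_uncons_tuple => //; exact: measurableX.
rewrite /lebesgue_cons /pushforward -comp_preimage.
rewrite (_ : _ \o _ = id); last by apply/funext => p /=; exact: cons_tupleK.
by rewrite preimage_id product_measure1E// lte_mul_pinfty// ge0_fin_numE.
Qed.

HB.instance Definition _ := Measure_isSigmaFinite.Build _ _ _ lebesgue_cons
  lebesgue_cons_sigma_finite.

End step.

(* n-dimensional Lebesgue measure: the n-fold product of the Lebesgue measure
   of R (a Dirac mass at the only point when n = 0). *)
Fixpoint lebesgue_tuple n : {sigma_finite_measure set (RT n) -> \bar R} :=
  if n is n'.+1 then lebesgue_cons (lebesgue_tuple n')
  else (\d_ ([tuple] : RT 0)).

End LebesgueTuple.

Section Euclidean.
Context {R : realType}.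

Definition dotp d (u v : 'rV[R]_d) : R := \sum_i u 0 i * v 0 i.

Definition enorm d (u : 'rV[R]_d) : R := Num.sqrt (dotp u u).

Definition vec d (t : d.-tuple (measurableTypeR R)) : 'rV[R]_d :=
  \row_i tnth t i.

(* The rows of [frame y] form an orthonormal basis of the hyperplane y^⊥ (for
   y != 0), so that w |-> w *m frame y is a linear isometry from R^(d-1) onto
   y^⊥. The set of such frames depends on the line of y only. *)
Definition frame d (y : 'rV[R]_d) : 'M[R]_(d.-1, d) :=
  xget 0 [set A | A *m A^T = 1%:M /\ A *m y^T = 0].

Variables (d : nat) (rad : R).

Definition ballR : set (d.-tuple (measurableTypeR R)) :=
  [set y | enorm (vec y) <= rad].

(* The part of y^⊥ in the ball, in the coordinates given by [frame y]; the
   (d-1)-dimensional Lebesgue measure of y^⊥ is the image of the one of R^(d-1)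
   under the isometry w |-> w *m frame y. *)
Definition ball_perp (y : 'rV[R]_d) : set (d.-1.-tuple (measurableTypeR R)) :=
  [set w | enorm (vec w *m frame y) <= rad].

Definition int_perp (y : 'rV[R]_d) (phi : 'rV[R]_d -> R) : R :=
  \int[lebesgue_tuple d.-1]_(w in ball_perp y) phi (vec w *m frame y).

(* ∫_{B_R} ∫_{B_R} φ(y,z) δ(y·z) dy dz *)
Definition int_delta (phi : 'rV[R]_d -> 'rV[R]_d -> R) : R :=
  \int[lebesgue_tuple d]_(y in ballR)
    ((enorm (vec y))^-1 * int_perp (vec y) (phi (vec y))).

(* Absolute convergence of [int_delta phi] as an iterated integral. *)
Definition delta_integrable (phi : 'rV[R]_d -> 'rV[R]_d -> R) : Prop :=
  [/\ {ae lebesgue_tuple d, forall y, ballR y ->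
        (lebesgue_tuple d.-1).-integrable (ball_perp (vec y))
          (fun w => (phi (vec y) (vec w *m frame (vec y)))%:E)},
      (lebesgue_tuple d).-integrable ballR (fun y =>
        ((enorm (vec y))^-1 * int_perp (vec y) (phi (vec y)))%:E) &
      (lebesgue_tuple d).-integrable ballR (fun y =>
        ((enorm (vec y))^-1 *
         int_perp (vec y) (fun z => `|phi (vec y) z|))%:E)].

End Euclidean.

Section Grids.
Context {R : realType}.
Variables (d n : nat) (T : R).

(* K enumerated without repetition: the vector a in {0, ..., 2n}^d stands for
   a - (n, ..., n). *)
Definition gridK : seq 'rV[int]_d :=
  [seq \row_i ((a i)%:Z - n%:Z) | a : {ffun 'I_d -> 'I_(2 * n).+1}].

Definition hstep : R := 2 * T / (2 * n).+1%:R.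

Definition gridX : seq 'rV[R]_d :=
  [seq hstep *: map_mx (fun a : int => a%:~R) k | k <- gridK].

Definition fourier (k : 'rV[int]_d) (v : 'rV[R]_d) : R[i] :=
  let x := pi / T * dotp (map_mx (fun a : int => a%:~R) k) v in
  cos x +i* sin x.

(* The representative of a modulo N = 2n+1 in {-n, ..., n}. *)
Definition smod1 (a : int) : int := ((a + n%:Z) %% (2 * n).+1%:Z)%Z - n%:Z.
Definition smod (l : 'rV[int]_d) : 'rV[int]_d := map_mx smod1 l.

Definition indN (l : 'rV[int]_d) : R[i] := (smod l == 0)%:R.

Definition jackson1 (beta : int) : R :=
  let b := `|beta|%:~R in
  let x := pi / n.+1%:R in
  ((n.+1%:R - b) * cos (x * b) + sin (x * b) * (cos x / sin x)) / n.+1%:R.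

Definition jackson (k : 'rV[int]_d) : R := \prod_i jackson1 (k 0 i).

End Grids.

Section Kernel.
Context {R : realType}.
Variables (d n : nat) (rad T : R) (b : R -> R -> R).

Definition collision_kernel (g w : 'rV[R]_d) : R :=
  b (enorm g) (`|dotp g w| / enorm g).

Definition kernel_tilde (y z : 'rV[R]_d) : R :=
  2 ^+ d.-1 * collision_kernel (y + z) ((enorm (y - z))^-1 *: (y - z))
  * enorm (y + z) ^ (2 - d%:Z).

Definition mode_integrand (l m : 'rV[int]_d) (y z : 'rV[R]_d) : R[i] :=
  (kernel_tilde y z)%:C * fourier T l y * fourier T m z.

Definition modes_converge : Prop := forall l m : 'rV[int]_d,
  delta_integrable rad (fun y z => complex.Re (mode_integrand l m y z)) /\
  delta_integrable rad (fun y z => complex.Im (mode_integrand l m y z)).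

Definition kernel_mode (l m : 'rV[int]_d) : R[i] :=
  int_delta rad (fun y z => complex.Re (mode_integrand l m y z)) +i*
  int_delta rad (fun y z => complex.Im (mode_integrand l m y z)).

Definition kernel_modeN (l m : 'rV[int]_d) : R[i] :=
  kernel_mode (smod n l) (smod n m).

Definition kernel_mode_sigma (l m : 'rV[int]_d) : R[i] :=
  kernel_modeN l m * (jackson n l)%:C * (jackson n m)%:C.

End Kernel.

Section Method.
Context {R : realType}.

(* Derivative of a complex-valued function of a real variable. *)
Definition is_cderive (g : R -> R[i]) (t : R) (w : R[i]) : Prop :=
  is_derive t 1 (fun s => complex.Re (g s)) (complex.Re w) /\
  is_derive t 1 (fun s => complex.Im (g s)) (complex.Im w).

Definition right_continuous_at (g : R -> R[i]) (t : R) : Prop :=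
  (complex.Re (g s) @[s --> t^'+] --> complex.Re (g t)) /\
  (complex.Im (g s) @[s --> t^'+] --> complex.Im (g t)).

Variables (d n : nat) (rad T : R) (b : R -> R -> R).

Definition ode_rhs (Fh : 'rV[int]_d -> R[i]) (k : 'rV[int]_d) : R[i] :=
  \sum_(l <- gridK d n) \sum_(m <- gridK d n)
    indN n (l + m - k) *
    (kernel_mode_sigma n rad T b l m - kernel_mode_sigma n rad T b m m) *
    Fh l * Fh m.

Definition initial_modes (f0 : 'rV[R]_d -> R) (k : 'rV[int]_d) : R[i] :=
  (((2 * n).+1 ^ d)%:R)^-1 *
  \sum_(r <- gridX d n T) (f0 r)%:C * fourier T (- k) r.

(* Fh is a solution of the initial value problem on [0, tau[; only its values
   Fh t k with k in the grid K matter. *)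
Definition entropic_solution (f0 : 'rV[R]_d -> R) (tau : \bar R)
    (Fh : R -> 'rV[int]_d -> R[i]) : Prop :=
  forall k, k \in gridK d n ->
  [/\ Fh 0 k = initial_modes f0 k,
      right_continuous_at (fun s => Fh s k) 0 &
      forall t : R, 0 < t -> (t%:E < tau)%E ->
        is_cderive (fun s => Fh s k) t (ode_rhs (Fh t) k)].

(* F_r(t), a priori complex; in R[i], 0 <= z means that z is real and
   nonnegative. *)
Definition grid_value (Fh : R -> 'rV[int]_d -> R[i]) (r : 'rV[R]_d) (t : R)
    : R[i] :=
  \sum_(k <- gridK d n) Fh t k * fourier T k r.

End Method.

(* Main.v *)
(* At the grid points the method is a discrete velocity model
     F_r' = sum_(p, q) A p q (F_(r+p) F_(r+q) - F_r F_(r+p+q)),  r in (Z/N)^d,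
   where A p q is the delta integral of the kernel against J (y - p) J (z - q),
   J being the Fourier sum of the filter. The filter is the autocorrelation of
   j |-> sin (pi j / (n + 1)), so J >= 0 and A >= 0. Changing y to - y or z to
   - z preserves the kernel on y _|_ z, so A is even in p and in q; this gives
   the weak form behind conservation of mass and the H-theorem. Gronwall's
   inequality applied to the squares of Im F and of min(Re F, 0) yields F >= 0.
   As x ln x is not differentiable at 0, one also needs that a value F_r that
   vanishes at one positive time vanishes identically: it does so before that
   time by F_r' >= - C F_r, and F_r' = 0 then forces every product F_(r+p)
   F_(r+q) with A p q > 0 to vanish, so that the zero set persists. *)

Require Import Defs.
From HB Require Import structures.
From mathcomp Require Import all_boot all_order all_algebra.
From mathcomp Require Import all_classical all_reals all_analysis.
From mathcomp Require Import measurable_realfun complex.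
From mathcomp Require Import ring lra zify.
Import Order.TTheory GRing.Theory Num.Theory.
Import numFieldNormedType.Exports.

Set Implicit Arguments.
Unset Strict Implicit.
Unset Printing Implicit Defensive.
Local Open Scope classical_set_scope.
Local Open Scope ring_scope.

(** * Gronwall inequalities *)

(** The subtracted modes B(m,m) are what makes the Fourier sum a collision sum: expanding F_(r+p+q)
    puts both shifts p and q on a single mode m, and the transform of A at (m,m) is B(m,m), while
    F_(r+p) F_(r+q) spreads them over two modes and gives B(l,m). A solution is only a family of
    complex numbers: neither the reality of the grid values nor a bound on them is given. The time
    interval is therefore cut at some B with t < B < [tau], so that continuity on [0, B] supplies a
    bound M, and F is split as u + i v. The equation for v is linear in v with zero initial data, so
    v = 0 is settled first and the sign of u afterwards. Positivity of A concerns a finite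
    combination of modes. Each mode converges separately but has an integrand of varying sign; only
    the combination is nonnegative, and only for orthogonal y and z. *)

Lemma is_derive_bigsum (R : realType) (I : Type) (s : seq I)
    (f : I -> R -> R) (df : I -> R) (t : R) :
  (forall i, is_derive t (1 : R) (f i) (df i)) ->
  is_derive t (1 : R) (fun x => \sum_(i <- s) f i x) (\sum_(i <- s) df i).
Proof.
move=> H; elim: s => [|i s IH].
  rewrite big_nil (_ : (fun=> _) = cst 0); first exact: is_derive_cst.
  by apply/funext => x; rewrite big_nil.
rewrite big_cons (_ : (fun=> _) = f i + (fun x => \sum_(j <- s) f j x)).
  exact: is_deriveD.
by apply/funext => x; rewrite big_cons.
Qed.

Lemma within_continuous_bigsum (R : realType) (I : Type) (s : seq I) (D : set R)
    (f : I -> R -> R) :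
  (forall i, {within D, continuous (f i)}) ->
  {within D, continuous (fun x => \sum_(i <- s) f i x)}.
Proof.
move=> H; elim: s => [|i s IH].
  rewrite (_ : (fun=> _) = cst 0); first by move=> x; exact: cst_continuous.
  by apply/funext => x; rewrite big_nil.
rewrite (_ : (fun=> _) = f i + (fun x => \sum_(j <- s) f j x)).
  by move=> x; apply: continuousD; [exact: H|exact: IH].
by apply/funext => x; rewrite big_cons.
Qed.

(** The derivative of [f t * expR (C * t)] is [expR (C * t) * (df t + C * f t)], which is
    nonnegative. Differentiability is asked on the open interval only, because at time 0 the data
    give right continuity and no more. *)
Lemma gronwall_ge (R : realType) (f df : R -> R) (a b C : R) : a <= b ->
  {within `[a, b], continuous f} ->
  (forall t, t \in `]a, b[ -> is_derive t (1 : R) f (df t)) ->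
  (forall t, t \in `]a, b[ -> - C * f t <= df t) ->
  f a * expR (C * a) <= f b * expR (C * b).
Proof.
move=> ab cf Hf Hd.
pose e := fun t : R => expR (C * t).
have de t : is_derive t (1 : R) e (C * e t).
  rewrite /e; have d1 : is_derive t (1 : R) (fun t => C * t) C.
    by apply: is_derive_eq; rewrite -[LHS]/(C * 1) mulr1.
  have := @is_derive1_comp R expR (fun t => C * t) t _ _ (is_derive_expR _) d1.
  by rewrite mulrC.
pose g := f * e.
have dg t : t \in `]a, b[ -> is_derive t (1 : R) g (f t *: (C * e t) + e t *: df t).
  by move=> tab; apply: is_deriveM; exact: Hf.
have cg : {within `[a, b], continuous g}.
  move=> x; apply: continuousM; first exact: cf.
  apply: continuous_subspaceT => y; apply: differentiable_continuous.
  by apply/derivable1_diffP; have [] := de y.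
have : g a <= g b; last by [].
apply: (@ger0_derive1_le_cc R g a b) => //.
- by move=> x /dg [].
- move=> x xab; rewrite derive1E (@derive_val _ _ _ _ _ _ _ (dg _ xab)).
  rewrite -[X in _ <= X]/(f x * (C * e x) + e x * df x).
  have := Hd _ xab; have := expR_gt0 (C * x); rewrite -/(e x).
  by move=> e0 H; rewrite (_ : _ + _ = e x * (df x - (- C * f x))); [apply: mulr_ge0; lra|ring].
- by rewrite in_itv /= lexx.
- by rewrite in_itv /= ab lexx.
Qed.

(** By the inequality of arithmetic and geometric means, the sum S of the squares satisfies S' <=
    |C| #|I| S, and [gronwall_ge] applied to -S forces S <= 0. Only the squares are differentiated,
    so that the lemma covers negative parts [Num.min u 0]. *)
Lemma gronwall_eq0 (R : realType) (I : finType) (x dx2 : I -> R -> R)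
    (a b C : R) :
  (forall i, {within `[a, b], continuous (x i)}) ->
  (forall i t, t \in `]a, b[ ->
     is_derive t (1 : R) (fun s => x i s ^+ 2) (dx2 i t)) ->
  (forall i t, t \in `]a, b[ ->
     dx2 i t <= C * `|x i t| * \sum_j `|x j t|) ->
  (forall i, x i a = 0) -> forall i t, t \in `[a, b] -> x i t = 0.
Proof.
move=> cx dx bx xa i t tab.
have tab' : a <= t <= b by move: tab; rewrite in_itv.
have sub s : s \in `]a, t[ -> s \in `]a, b[.
  rewrite !in_itv /= => /andP[-> st]; apply: lt_le_trans st _.
  by case/andP: tab'.
pose f := fun s => - \sum_j x j s ^+ 2.
pose K := `|C| * (#|I|%:R).
suff : f a * expR (- K * a) <= f t * expR (- K * t).
  have -> : f a = 0 by rewrite /f big1 ?oppr0// => j _; rewrite xa expr0n.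
  rewrite mul0r pmulr_lge0 ?expR_gt0// oppr_ge0 => H.
  have S0 : \sum_j x j t ^+ 2 = 0.
    by apply/eqP; rewrite eq_le H sumr_ge0// => j _; exact: sqr_ge0.
  have /eqP := psumr_eq0P (fun j _ => sqr_ge0 (x j t)) S0 (i := i) isT.
  by rewrite sqrf_eq0 => /eqP.
apply: (@gronwall_ge _ f (fun s => - \sum_j dx2 j s)).
- by case/andP: tab'.
- have ct j : {within `[a, t], continuous (fun s => x j s ^+ 2)}.
    have cxt : {within `[a, t], continuous (x j)}.
      apply: continuous_subspaceW (cx j) => s /=; rewrite !in_itv /= => /andP[-> st].
      by apply: le_trans st _; case/andP: tab'.
    by move=> s; apply: continuousM; exact: cxt.
  by move=> s; apply: continuousN; exact: within_continuous_bigsum.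
- move=> s /sub sab.
  by apply: is_deriveN; apply: is_derive_bigsum => j; exact: dx.
- move=> s /sub sab; rewrite opprK /f mulrN lerN2.
  apply: (@le_trans _ _ (\sum_j C * `|x j s| * \sum_k `|x k s|)).
    by apply: ler_sum => j _; exact: bx.
  have X0 j : 0 <= `|x j s| by [].
  apply: (@le_trans _ _ (`|C| * \sum_j \sum_k `|x j s| * `|x k s|)).
    rewrite mulr_sumr; apply: ler_sum => j _.
    rewrite -mulr_sumr -mulrA; apply: ler_wpM2r; last exact: ler_norm.
    by apply: mulr_ge0 => //; apply: sumr_ge0.
  rewrite /K -mulrA; apply: ler_wpM2l => //.
  apply: (@le_trans _ _ (\sum_j \sum_k (x j s ^+ 2 / 2 + x k s ^+ 2 / 2))).
    apply: ler_sum => j _; apply: ler_sum => k _.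
    rewrite -[x j s ^+ 2]real_normK ?num_real// -[x k s ^+ 2]real_normK ?num_real//.
    have := sqr_ge0 (`|x j s| - `|x k s|); nra.
  rewrite le_eqVlt; apply/orP; left; apply/eqP.
  have E j : \sum_k (x j s ^+ 2 / 2 + x k s ^+ 2 / 2) =
      #|I|%:R * (x j s ^+ 2 / 2) + (\sum_k x k s ^+ 2) / 2.
    by rewrite big_split sumr_const mulr_natl -mulr_suml.
  rewrite (eq_bigr _ (fun j _ => E j)) big_split /= -mulr_sumr -mulr_suml.
  by rewrite sumr_const -[_ *+ _]mulr_natl; move: (\sum_j _) => S; field.
Qed.

(** * The discrete velocity model *)

(** Squaring removes the kink of the negative part: at 0 the difference quotient is at most |h| in
    absolute value. *)
Lemma is_derive_sqr_min0 (R : realType) (x : R) :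
  is_derive x (1 : R) (fun y => Num.min y 0 ^+ 2) (2 * Num.min x 0).
Proof.
have [x0|x0|->] := ltgtP x 0.
- apply: (@near_eq_is_derive _ _ _ (fun y : R => y ^+ 2)).
  + near=> y; rewrite min_l//; apply/ltW; near: y; exact: lt_nbhsl.
  + by apply: is_derive_eq; rewrite -[x%:A]/(x * 1); ring.
- rewrite mulr0; apply: (@near_eq_is_derive _ _ _ (cst (0 : R))).
  near=> y; rewrite /= min_r ?expr0n//; apply/ltW; near: y; exact: lt_nbhsr.
- rewrite mulr0.
  have E : (fun h : R => h^-1 *: ((Num.min (h *: (1 : R) + 0) 0) ^+ 2 - (Num.min (0 : R) 0) ^+ 2))
      @ 0^' --> (0 : R).
    apply/cvgr0Pnorm_lt => e e0; near=> h.
    have h0 : h != 0 by near: h; exact: nbhs_dnbhs_neq.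
    rewrite minxx expr0n subr0 addr0 -[_ *: 1]/(h * 1) mulr1 -[_ *: _]/(_ * _).
    apply: (@le_lt_trans _ _ `|h|); last first.
      near: h; apply: dnbhs0_lt; exact: e0.
    rewrite normrM normfV ler_pdivrMl ?normr_gt0// normrX expr2.
    have : `|Num.min h 0| <= `|h| by rewrite /Num.min; case: ifP => // _; rewrite normr0.
    by move=> H; apply: ler_pM.
  split; first by apply/cvg_ex; exists 0; exact: E.
  by rewrite /derive; apply/cvg_lim.
Unshelve. all: by end_near. Qed.

(** Kept bilinear and over any [numDomainType]: the same sum serves for the complex grid values and
    for their real and imaginary parts, whose equations contain mixed sums. *)
Definition collision (G : finZmodType) (K : numDomainType) (A : G -> G -> K)
    (u v : G -> K) (r : G) : K :=
  \sum_p \sum_q A p q * (u (r + p) * v (r + q) - u r * v (r + p + q)).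

(** * Weak form of the collision sum *)

Section WeakForm.
Variables (G : finZmodType) (K : numDomainType) (A : G -> G -> K).
Hypothesis AN1 : forall p q, A (- p) q = A p q.
Hypothesis AN2 : forall p q, A p (- q) = A p q.

Let sum3 (f : G -> G -> G -> K) := \sum_r \sum_p \sum_q f r p q.

(** The substitution r -> r + p, p -> -p exchanges r with r + p and r + q with r + p + q, in the
    parallelogram on which a collision lives. *)
Lemma sum3_flip1 (f : G -> G -> G -> K) :
  sum3 f = sum3 (fun r p q => f (r + p) (- p) q).
Proof.
rewrite /sum3 exchange_big /= (reindex_inj oppr_inj) /= [RHS]exchange_big /=.
by apply: eq_bigr => p _; rewrite (reindex_inj (addIr p)).
Qed.

Lemma sum3_flip2 (f : G -> G -> G -> K) :
  sum3 f = sum3 (fun r p q => f (r + q) p (- q)).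
Proof.
rewrite /sum3 exchange_big [RHS]exchange_big /=; apply: eq_bigr => p _.
rewrite exchange_big /= (reindex_inj oppr_inj) /= [RHS]exchange_big /=.
by apply: eq_bigr => q _; rewrite (reindex_inj (addIr q)).
Qed.

(** Each flip preserves [A], which is even, and reverses the sign of the difference of products.
    Adding the four resulting forms of the same sum gives the alternating weight; the factor 4
    avoids a division. *)
Lemma collision_weak (u w : G -> K) :
  (\sum_r w r * collision A u u r) *+ 4 =
  \sum_r \sum_p \sum_q A p q * (u (r + p) * u (r + q) - u r * u (r + p + q)) *
    (w r - w (r + p) - w (r + q) + w (r + p + q)).
Proof.
pose D r p q := A p q * (u (r + p) * u (r + q) - u r * u (r + p + q)).
pose f r p q := w r * D r p q.
have -> : \sum_r w r * collision A u u r = sum3 f.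
  apply: eq_bigr => r _; rewrite /collision mulr_sumr; apply: eq_bigr => p _.
  by rewrite mulr_sumr.
have E1 : sum3 f = sum3 (fun r p q => - w (r + p) * D r p q).
  rewrite sum3_flip1; apply: eq_bigr => r _; apply: eq_bigr => p _.
  by apply: eq_bigr => q _; rewrite /f /D AN1 addrK; ring.
have E2 : sum3 f = sum3 (fun r p q => - w (r + q) * D r p q).
  rewrite sum3_flip2; apply: eq_bigr => r _; apply: eq_bigr => p _.
  apply: eq_bigr => q _; rewrite /f /D AN2 addrK.
  by rewrite (addrAC (r + q)) addrK (addrAC r q); ring.
have E3 : sum3 f = sum3 (fun r p q => w (r + p + q) * D r p q).
  rewrite E1 sum3_flip2; apply: eq_bigr => r _; apply: eq_bigr => p _.
  apply: eq_bigr => q _; rewrite /f /D AN2 addrK.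
  by rewrite (addrAC (r + q)) addrK (addrAC r q); ring.
rewrite -[4%N]/(1 + 1 + 1 + 1)%N !mulrnDr {2}E1 {2}E2 {2}E3 /sum3 -!big_split.
apply: eq_bigr => r _; rewrite -!big_split; apply: eq_bigr => p _.
rewrite -!big_split; apply: eq_bigr => q _ /=.
by rewrite /f -/(D r p q); ring.
Qed.

Lemma sum_collision (u : G -> K) : \sum_r collision A u u r = 0.
Proof.
have E := collision_weak u (fun=> 1).
have /eqP : (\sum_r collision A u u r) *+ 4 = 0.
  under [X in X *+ _]eq_bigr do rewrite -[collision _ _ _ _]mul1r.
  rewrite E big1// => r _; rewrite big1// => p _; rewrite big1// => q _.
  by rewrite subrr add0r addNr mulr0.
by rewrite mulrn_eq0 => /eqP.
Qed.

End WeakForm.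

Lemma within_continuous_bounded (R : realType) (I : finType) (f : I -> R -> R)
    (a b : R) : a <= b -> (forall i, {within `[a, b], continuous (f i)}) ->
  exists2 M : R, 0 <= M & forall i t, t \in `[a, b] -> `|f i t| <= M.
Proof.
move=> ab cf; pose g s := \sum_i `|f i s|.
have cg : {within `[a, b], continuous g}.
  apply: within_continuous_bigsum => i x.
  apply: (@continuous_comp (subspace `[a, b]) R R (f i) Num.norm).
    exact: cf.
  exact: norm_continuous.
have [c _ Hc] := EVT_max ab cg.
exists (g c) => [|i t /Hc]; first exact: sumr_ge0.
apply: le_trans; rewrite /g (bigD1 i)//= lerDl; exact: sumr_ge0.
Qed.

Section CollisionBounds.
Variables (R : realFieldType) (G : finZmodType) (A : G -> G -> R).
Hypothesis A0 : forall p q, 0 <= A p q.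

(** The common source of the bounds on collision sums, with weight [w] equal to 1, -1, a density or
    its negative part. The termwise bound is asked only where [A p q > 0], since the vanishing of
    products at a zero of the density is known only there. *)
Lemma collision_le_mass (f g : G -> R) (r : G) (c : R) (w : R) :
  (forall p q, 0 < A p q ->
     w * (f (r + p) * g (r + q) - f r * g (r + p + q)) <= c) ->
  w * collision A f g r <= (\sum_p \sum_q A p q) * c.
Proof.
move=> H; rewrite /collision mulr_sumr mulr_suml; apply: ler_sum => p _.
rewrite mulr_sumr mulr_suml; apply: ler_sum => q _.
rewrite mulrCA; have := A0 p q; rewrite le_eqVlt => /orP[/eqP <-|/[dup] /ltW A0'].
  by rewrite !mul0r.
by move=> /H; exact: ler_wpM2l.
Qed.

Lemma collision_norm_le (f g : G -> R) (r : G) (M N : R) :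
  (forall s, `|f s| <= M) -> (forall s, `|g s| <= N) ->
  `|collision A f g r| <= (\sum_p \sum_q A p q) * (2 * (M * N)).
Proof.
move=> fM gN.
have H w : `|w| = 1 -> forall p q,
    w * (f (r + p) * g (r + q) - f r * g (r + p + q)) <= 2 * (M * N).
  move=> w1 p q; apply: le_trans (ler_norm _) _; rewrite normrM w1 mul1r.
  apply: le_trans (ler_normB _ _) _; rewrite !normrM mulr_natl mulr2n.
  by apply: lerD; apply: ler_pM.
rewrite ler_norml; apply/andP; split.
- rewrite lerNl -mulN1r; apply: collision_le_mass => p q _.
  by apply: H; rewrite normrN normr1.
- rewrite -[collision _ _ _ _]mul1r; apply: collision_le_mass => p q _.
  by apply: H; rewrite normr1.
Qed.

(** Where [u r] is negative, the gain is at least -M S, because a product of two values is negative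
    only if one factor is, and that factor has size at most S. The loss also has size at most M S,
    since |u r| <= S. The bound is thus quadratic in the negative parts, as [gronwall_eq0]
    requires. *)
Lemma collision_neg_part_le (u : G -> R) (M S : R) (r : G) :
  (forall s, `|u s| <= M) -> (forall s, `|Num.min (u s) 0| <= S) ->
  Num.min (u r) 0 * collision A u u r <=
  (\sum_p \sum_q A p q) * (`|Num.min (u r) 0| * (2 * (M * S))).
Proof.
move=> uM uS; have M0 : 0 <= M by apply: le_trans (uM r).
have S0 : 0 <= S by apply: le_trans (uS r).
have prod x y : `|x| <= M -> `|y| <= M -> `|Num.min x 0| <= S ->
    `|Num.min y 0| <= S -> - (M * S) <= x * y.
  rewrite !ler_norml => /andP[x1 x2] /andP[y1 y2].
  case: (leP x 0) => x0; case: (leP y 0) => y0 /andP[xS xS'] /andP[yS yS']; nra.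
apply: collision_le_mass => p q _.
have /(_ (uM _) (uM _) (uS _) (uS _)) H := prod (u (r + p)) (u (r + q)).
have := uM (r + p + q); have := uM r; have := uS r.
case: (leP (u r) 0) => ur; last by rewrite normr0 !mul0r.
rewrite (ler0_norm ur) ler_norml => h1 h2 /andP[h3 h4].
have : u r * (u (r + p) * u (r + q)) <= - u r * (M * S) by nra.
have : - u r * (u r * u (r + p + q)) <= - u r * (M * S); last by nra.
have : - u r * (M * S) - (- u r * (u r * u (r + p + q))) =
  - u r * (M * (S + u r) + - u r * (M + u (r + p + q))) by ring.
have : 0 <= - u r * (M * (S + u r) + - u r * (M + u (r + p + q))).
  by apply: mulr_ge0; [lra|apply: addr_ge0; apply: mulr_ge0; lra].
lra.
Qed.

End CollisionBounds.

(** * Positivity, persistence of zeros and entropy decay *)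

Section DiscreteVelocityModel.
Variables (R : realType) (G : finZmodType) (A : G -> G -> R).
Hypothesis A0 : forall p q, 0 <= A p q.
Hypothesis AN1 : forall p q, A (- p) q = A p q.
Hypothesis AN2 : forall p q, A p (- q) = A p q.
Variables (u v : G -> R -> R) (b : R).
Hypothesis b0 : 0 < b.
Hypothesis cu : forall r, {within `[0, b], continuous (u r)}.
Hypothesis cv : forall r, {within `[0, b], continuous (v r)}.
Hypothesis du : forall r (t : R), t \in `]0, b[ -> is_derive t (1 : R) (u r)
  (collision A (u^~ t) (u^~ t) r - collision A (v^~ t) (v^~ t) r).
Hypothesis dv : forall r (t : R), t \in `]0, b[ -> is_derive t (1 : R) (v r)
  (collision A (u^~ t) (v^~ t) r + collision A (v^~ t) (u^~ t) r).
Hypothesis u_init : forall r, 0 <= u r 0.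
Hypothesis v_init : forall r, v r 0 = 0.

Let mass := \sum_p \sum_q A p q.

Let subcc (t : R) : t \in `]0, b[ -> t \in `[0, b].
Proof. by apply: subset_itv_oo_cc. Qed.

Let le_abs_sum (x : G -> R) s : `|x s| <= \sum_j `|x j|.
Proof. by rewrite (bigD1 s)//= lerDl sumr_ge0. Qed.

(** Once [u] is bounded by M, the derivative of [v r] has size at most 4 [mass] M S, with S the sum
    of the |v j|; differentiating the square doubles the constant to 8. *)
Lemma imaginary_part_eq0 r (t : R) : t \in `[0, b] -> v r t = 0.
Proof.
have [M M0 uM] := within_continuous_bounded (ltW b0) cu.
apply: (gronwall_eq0 (C := 8 * (mass * M)) (dx2 := fun r t =>
    2 * (v r t * (collision A (u^~ t) (v^~ t) r + collision A (v^~ t) (u^~ t) r)))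
    cv _ _ v_init) => {t}r t tb.
  have dvr := dv r tb; apply: is_derive_eq.
  by rewrite /GRing.scale /=; ring.
set S := \sum_j _.
apply: le_trans (ler_norm _) _; rewrite !normrM ger0_norm//.
rewrite (_ : 8 * _ * _ * S = 2 * (`|v r t| * (4 * (mass * M * S)))); last by ring.
apply: ler_wpM2l => //; apply: ler_wpM2l => //.
apply: le_trans (ler_normD _ _) _.
have uMt s : `|u s t| <= M by apply/uM/subcc.
have vSt s : `|v s t| <= S by exact: (le_abs_sum (v^~ t)).
have := collision_norm_le A0 r uMt vSt; have := collision_norm_le A0 r vSt uMt.
rewrite -/mass; lra.
Qed.

Lemma is_derive_density r (t : R) : t \in `]0, b[ ->
  is_derive t (1 : R) (u r) (collision A (u^~ t) (u^~ t) r).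
Proof.
move=> tb; apply: is_derive_eq (du r tb) _.
rewrite [X in _ - X]big1 ?subr0// => p _; rewrite big1// => q _.
by rewrite !imaginary_part_eq0 ?subcc// mulr0 subrr mulr0.
Qed.

Lemma density_ge0 r (t : R) : t \in `[0, b] -> 0 <= u r t.
Proof.
have [M M0 uM] := within_continuous_bounded (ltW b0) cu.
suff H : forall r t, t \in `[0, b] -> Num.min (u r t) 0 = 0.
  by move=> tb; rewrite -(H r t tb) ge_min lexx.
apply: (gronwall_eq0 (C := 4 * (mass * M)) (x := fun r t => Num.min (u r t) 0)
    (dx2 := fun r t => 2 * Num.min (u r t) 0 * collision A (u^~ t) (u^~ t) r)).
- move=> s; apply: (@min_fun_continuous _ (subspace `[0, b]) R (u s) (fun=> 0)).
    exact: cu.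
  by move=> x; exact: cst_continuous.
- move=> {t}r t tb.
  exact: (@is_derive1_comp R (fun y => Num.min y 0 ^+ 2) (u r) t _ _
    (is_derive_sqr_min0 _) (is_derive_density r tb)).
- move=> {t}r t tb; set S := \sum_j _; rewrite -mulrA.
  have uMt s : `|u s t| <= M by apply/uM/subcc.
  have uSt s : `|Num.min (u s t) 0| <= S.
    exact: (le_abs_sum (fun s => Num.min (u s t) 0)).
  have := collision_neg_part_le A0 r uMt uSt; rewrite -/mass; lra.
- by move=> s; rewrite min_r.
Qed.

(** The gain is nonnegative and the loss is at most [mass * M * u r s], so
    [u r s * expR (mass * M * s)] is nondecreasing: its zero at t0 caps all earlier values at 0. *)
Lemma density_zero_before r (t0 : R) : t0 \in `]0, b[ -> u r t0 = 0 ->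
  forall t : R, t \in `[0, t0] -> u r t = 0.
Proof.
move=> t0b ur0 t; rewrite in_itv /= => /andP[t_ge0 t_le].
move: (t0b); rewrite in_itv /= => /andP[t0_gt0 t0_ltb].
have [M M0 uM] := within_continuous_bounded (ltW b0) cu.
have : u r t * expR (mass * M * t) <= u r t0 * expR (mass * M * t0).
  have cut : {within `[t, t0], continuous (u r)}.
    by apply: (continuous_subspaceW _ (@cu r)) => s /=; rewrite !in_itv /=; lra.
  have dut s : s \in `]t, t0[ -> is_derive s (1 : R) (u r)
      (collision A (u^~ s) (u^~ s) r).
    by move=> st; apply: is_derive_density; move: st; rewrite !in_itv /=; lra.
  apply: (gronwall_ge t_le cut dut) => s st.
  have sb : s \in `[0, b] by move: st; rewrite !in_itv /=; lra.
  have : -1 * collision A (u^~ s) (u^~ s) r <= mass * (u r s * M).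
    apply: collision_le_mass => // p q _.
    have := density_ge0 r sb; have := density_ge0 (r + p) sb.
    have := density_ge0 (r + q) sb; have := density_ge0 (r + p + q) sb.
    have := uM (r + p + q) _ sb; rewrite ler_norml => /andP[_]; nra.
  lra.
have tb : t \in `[0, b] by rewrite in_itv /=; lra.
rewrite ur0 mul0r pmulr_lle0 ?expR_gt0// => ut.
by apply/eqP; rewrite eq_le ut density_ge0.
Qed.

(** The zero is an interior minimum of the nonnegative function [u r], and the collision sum is its
    derivative there. *)
Lemma density_zero_collision r (t0 : R) : t0 \in `]0, b[ -> u r t0 = 0 ->
  collision A (u^~ t0) (u^~ t0) r = 0.
Proof.
move=> t0b ur0.
have H1 := is_derive_density r t0b.
have H2 : is_derive t0 (1 : R) (u r) 0.
  apply: (@derive1_at_min R (u r) 0 b t0) => //; first exact: ltW.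
    by move=> s sb; have [] := is_derive_density r sb.
  by move=> s sb; rewrite ur0 density_ge0// subcc.
by rewrite -(@derive_val _ _ _ _ _ _ _ H1) (@derive_val _ _ _ _ _ _ _ H2).
Qed.

Lemma density_zero_pair r (t0 : R) p q : t0 \in `]0, b[ -> u r t0 = 0 ->
  0 < A p q -> u (r + p) t0 * u (r + q) t0 = 0.
Proof.
move=> t0b ur0 Apq.
have U s : 0 <= u s t0 by apply/density_ge0/subcc.
have term_ge0 p' q' : 0 <= A p' q' * (u (r + p') t0 * u (r + q') t0).
  by rewrite !mulr_ge0.
have := density_zero_collision t0b ur0; rewrite /collision ur0.
under eq_bigr do under eq_bigr do rewrite mul0r subr0.
move/psumr_eq0P => /(_ _ p isT) H.
have /psumr_eq0P/(_ q isT) : \sum_q A p q * (u (r + p) t0 * u (r + q) t0) = 0.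
  by apply: H => p' _; apply: sumr_ge0.
by move=> H'; apply/eqP; have /eqP := H' (fun q _ => term_ge0 p q);
  rewrite mulf_eq0 (gt_eqF Apq).
Qed.

Lemma density_zero_after r (t0 : R) : t0 \in `]0, b[ -> u r t0 = 0 ->
  forall t : R, t \in `[t0, b] -> u r t = 0.
Proof.
move=> t0b ur0 t tb.
move: (t0b); rewrite in_itv /= => /andP[t0_gt0 t0_ltb].
have [M M0 uM] := within_continuous_bounded (ltW b0) cu.
(* [x] restricts [u] to the set Z of sites that vanish at the fixed time t0. If s is in Z and
   [A p q > 0], then [density_zero_pair] at t0 puts s + p or s + q in Z. Hence at every later time
   the gain at s is at most M times the sum of [u] over Z: the inequalities close on Z. *)
pose x s t := if u s t0 == 0 then u s t else 0.
suff : x r t = 0 by rewrite /x ur0 eqxx.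
have cx s : {within `[t0, b], continuous (x s)}.
  rewrite /x; case: (u s t0 == 0); last by move=> y; exact: cst_continuous.
  apply: (continuous_subspaceW _ (@cu s)) => t1 /=; rewrite !in_itv /=; lra.
pose dx2 s t := if u s t0 == 0
  then 2 * (u s t * collision A (u^~ t) (u^~ t) s) else 0.
have dx s t1 : t1 \in `]t0, b[ ->
    is_derive t1 (1 : R) (fun t => x s t ^+ 2) (dx2 s t1).
  move=> t1b; rewrite /x /dx2; case: ifP => _.
    have H : is_derive t1 (1 : R) (u s) (collision A (u^~ t1) (u^~ t1) s).
      by apply: is_derive_density; move: t1b; rewrite !in_itv /=; lra.
    by apply: is_derive_eq; rewrite /GRing.scale /=; ring.
  rewrite (_ : (fun=> _) = cst 0); first exact: is_derive_cst.
  by apply/funext => ?; rewrite expr0n.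
have bx s t1 : t1 \in `]t0, b[ ->
    dx2 s t1 <= 2 * (mass * M) * `|x s t1| * \sum_j `|x j t1|.
  move=> t1t; have t1b : t1 \in `[0, b] by move: t1t; rewrite !in_itv /=; lra.
  have U y : 0 <= u y t1 by exact: density_ge0.
  set S := \sum_j _.
  have xS y : u y t0 = 0 -> u y t1 <= S.
    move=> y0; have := le_abs_sum (x^~ t1) y; rewrite {1}/x y0 eqxx.
    by rewrite ger0_norm.
  have S0 : 0 <= S by apply: sumr_ge0.
  have UM y : u y t1 <= M by apply: le_trans (ler_norm _) _; exact: uM.
  rewrite /dx2 {1}/x; case: ifP => [/eqP s0|_]; last by rewrite normr0 mulr0 mul0r.
  have : u s t1 * collision A (u^~ t1) (u^~ t1) s <= mass * (u s t1 * (M * S)).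
    apply: collision_le_mass => // p q Apq; apply: ler_wpM2l => //.
    have : u (s + p) t1 * u (s + q) t1 <= M * S.
      have /eqP := density_zero_pair t0b s0 Apq; rewrite mulf_eq0.
      case/orP => /eqP /xS H; last by apply: ler_pM.
      by rewrite mulrC; apply: ler_pM.
    have := mulr_ge0 (U s) (U (s + p + q)); lra.
  by rewrite (ger0_norm (U s)); lra.
by apply: (gronwall_eq0 cx dx bx) => // s; rewrite /x; case: eqP.
Qed.

(* Where u r t = 0 the collision sum vanishes, so the junk value ln 0 = 0 is
   harmless. *)
Lemma is_derive_entropy_density r (t : R) : t \in `]0, b[ ->
  is_derive t (1 : R) (fun s => u r s * ln (u r s))
    (collision A (u^~ t) (u^~ t) r * (1 + ln (u r t))).
Proof.
move=> tb; have H := is_derive_density r tb.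
have := density_ge0 r (subcc tb); rewrite le_eqVlt => /orP[/eqP/esym u0|u0].
  rewrite density_zero_collision// mul0r.
  apply: (@near_eq_is_derive _ _ _ (cst (0 : R))).
  near=> s => /=.
  have sb : s \in `]0, b[ by near: s; exact: near_in_itvoo.
  suff -> : u r s = 0 by rewrite mul0r.
  move: (sb); rewrite in_itv /= => /andP[s0 sltb].
  have [st|ts] := leP s t.
    by apply: (density_zero_before tb u0); rewrite in_itv /= st ltW.
  by apply: (density_zero_after tb u0); rewrite in_itv /= !ltW.
have L : is_derive t (1 : R) (fun s => ln (u r s))
    ((u r t)^-1 * collision A (u^~ t) (u^~ t) r).
  exact: (@is_derive1_comp R (@ln R) (u r) t _ _ (is_derive1_ln u0) H).
apply: is_derive_eq; rewrite /GRing.scale /=; field.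
by rewrite gt_eqF.
Unshelve. all: by end_near. Qed.

Theorem discrete_entropy_decreasing (t : R) : t \in `]0, b[ ->
  let H s := \sum_r u r s * ln (u r s) in derivable H t 1 /\ 'D_1 H t <= 0.
Proof.
move=> tb H.
have dH : is_derive t (1 : R) H
    (\sum_r collision A (u^~ t) (u^~ t) r * (1 + ln (u r t))).
  by apply: is_derive_bigsum => r; exact: is_derive_entropy_density.
split; first by have [] := dH.
rewrite (@derive_val _ _ _ _ _ _ _ dH).
(* The summand 1 of [1 + ln] contributes the derivative of the mass, which is 0. *)
under eq_bigr do rewrite mulrDr mulr1 mulrC.
rewrite big_split /= (sum_collision AN1 AN2) add0r.
rewrite -(pmulrn_lle0 _ (isT : (0 < 4)%N)) (collision_weak AN1 AN2).
have U s : 0 <= u s t by apply/density_ge0/subcc.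
apply: sumr_le0 => r _; apply: sumr_le0 => p _; apply: sumr_le0 => q _.
have := A0 p q; rewrite le_eqVlt => /orP[/eqP <-|Apq]; first by rewrite !mul0r.
rewrite -mulrA pmulr_rle0//.
(* The logarithm of a product splits only for positive factors, so zeros are treated apart. If one
   corner of the parallelogram vanishes, [density_zero_pair] read from that corner, with the signs
   of p and q adjusted by the evenness of [A], makes the product of its two neighbours vanish as
   well. *)
have zero : u (r + p) t * u (r + q) t = 0 -> u r t * u (r + p + q) t = 0 ->
    (u (r + p) t * u (r + q) t - u r t * u (r + p + q) t) * (ln (u r t) -
      ln (u (r + p) t) - ln (u (r + q) t) + ln (u (r + p + q) t)) <= 0.
  by move=> -> ->; rewrite subrr mul0r.
have [r0|r0] := eqVneq (u r t) 0.
  by apply: zero; [exact: density_zero_pair|rewrite r0 mul0r].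
have [s0|s0] := eqVneq (u (r + p + q) t) 0.
  apply: zero; last by rewrite s0 mulr0.
  have := density_zero_pair (p := - p) (q := - q) tb s0.
  by rewrite AN1 AN2 addrK (addrAC r) addrK mulrC; exact.
have [p0|p0] := eqVneq (u (r + p) t) 0.
  apply: zero; first by rewrite p0 mul0r.
  by have := density_zero_pair (p := - p) (q := q) tb p0; rewrite AN1 addrK; exact.
have [q0|q0] := eqVneq (u (r + q) t) 0.
  apply: zero; first by rewrite q0 mulr0.
  have := density_zero_pair (p := p) (q := - q) tb q0.
  by rewrite AN2 addrK (addrAC r) mulrC; exact.
have gt s : u s t != 0 -> 0 < u s t by move=> ?; rewrite lt0r U andbT.
rewrite (_ : ln (u r t) - _ - _ + _ =
  ln (u r t * u (r + p + q) t) - ln (u (r + p) t * u (r + q) t)); last first.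
  by rewrite !lnM ?posrE ?gt//; ring.
have X0 := mulr_gt0 (gt _ p0) (gt _ q0); have Y0 := mulr_gt0 (gt _ r0) (gt _ s0).
move: X0 Y0; set X := u (r + p) t * _; set Y := u r t * _ => X0 Y0.
have [XY|/ltW YX] := leP X Y.
  by rewrite mulr_le0_ge0 ?subr_le0 ?subr_ge0 ?ler_ln.
by rewrite mulr_ge0_le0 ?subr_le0 ?subr_ge0 ?ler_ln.
Qed.

End DiscreteVelocityModel.

(** * Symmetries and positivity of the kernel modes *)

Section MeasurePreservingInvolution.
Context d (T : measurableType d) (R : realType).
Variables (mu : {measure set T -> \bar R}) (phi : T -> T).
Hypothesis mphi : measurable_fun setT phi.
Hypothesis phiK : involutive phi.
Hypothesis phi_mu : forall B, measurable B -> mu (phi @^-1` B) = mu B.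
Local Open Scope ereal_scope.
Import HBNNSimple.

(** The argument stays at the level of the supremum over simple functions, so that [f] need not be
    measurable: convergence of the modes controls the inner integrals only for almost every y,
    whereas the change of variables is wanted for all y. The witness is the pullback of [h] along
    [phi]. *)
Lemma sintegral_comp_le (f : T -> \bar R) (h : {nnsfun T >-> R}) :
  (forall x, (h x)%:E <= f x) ->
  exists2 k : {nnsfun T >-> R}, (forall x, (k x)%:E <= f (phi x)) &
    sintegral mu k = sintegral mu h.
Proof.
move=> hf.
pose mk := isMeasurableFun.Build _ _ _ _ (h \o phi)
  (measurableT_comp (measurable_funPT h) mphi).
have fk : finite_set (range (h \o phi)).
  by apply: sub_finite_set (fimfunP h) => _ [x _ <-]; exists (phi x).
pose fm := FiniteImage.Build _ _ (h \o phi) fk.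
have nk x : (0 <= (h \o phi) x)%R by exact: fun_ge0.
pose nm := isNonNegFun.Build _ _ (h \o phi) nk.
pose k : {nnsfun T >-> R} := HB.pack (h \o phi) mk fm nm.
exists k => [x|]; first exact: hf.
rewrite /sintegral; apply: eq_fsbigr => y _; congr (_ * _).
by rewrite (_ : k @^-1` _ = phi @^-1` (h @^-1` [set y]))// phi_mu.
Qed.

Lemma ge0_integralT_comp_involution (f : T -> \bar R) : (forall x, 0 <= f x) ->
  \int[mu]_x f (phi x) = \int[mu]_x f x.
Proof.
move=> f0; rewrite !ge0_integralTE//; congr ereal_sup; apply/seteqP.
split=> _ [h /= hf <-].
- have [k kf <-] := sintegral_comp_le hf.
  by exists k => // x; rewrite -[x in f x]phiK.
- by have [k kf <-] := sintegral_comp_le hf; exists k.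
Qed.

Lemma integralT_comp_involution (f : T -> \bar R) :
  \int[mu]_x f (phi x) = \int[mu]_x f x.
Proof.
rewrite integralE [RHS]integralE -[X in _ = X - _]ge0_integralT_comp_involution//.
rewrite -[X in _ = _ - X]ge0_integralT_comp_involution//.
by rewrite -[fun x => f (phi x)]/(f \o phi) funepos_comp funeneg_comp.
Qed.

Lemma integral_comp_involution (D : set T) (f : T -> \bar R) :
  phi @^-1` D = D -> \int[mu]_(x in D) f (phi x) = \int[mu]_(x in D) f x.
Proof.
move=> DE; rewrite integral_mkcond [RHS]integral_mkcond.
rewrite -[RHS]integralT_comp_involution; apply: eq_integral => x _.
rewrite /patch; have -> // : (phi x \in D) = (x \in D).
by rewrite -[in RHS]DE; apply/idP/idP; rewrite !inE.
Qed.

End MeasurePreservingInvolution.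

Section TupleNegation.
Context {R : realType}.
Local Notation RR := (measurableTypeR R).
Local Notation RT n := (n.-tuple RR).

Definition tuple_opp n (t : RT n) : RT n := [tuple of map -%R t].

Lemma vec_tuple_opp n (t : RT n) : vec (tuple_opp t) = - vec t.
Proof. by apply/rowP => i; rewrite !mxE tnth_map. Qed.

Lemma tuple_oppK n : involutive (@tuple_opp n).
Proof. by move=> t; apply: eq_from_tnth => i; rewrite !tnth_map opprK. Qed.

Lemma measurable_tuple_opp n : measurable_fun [set: RT n] (@tuple_opp n).
Proof.
apply/measurable_fun_tnthP => i.
rewrite (_ : _ \o _ = -%R \o (@tnth _ _)^~ i).
  by apply: measurableT_comp => //; exact: measurable_tnth.
by apply/funext => t /=; rewrite tnth_map.
Qed.

(** The first coordinate is reflected by the invariance of the Lebesgue measure of the line, the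
    sections over it by induction. *)
Lemma lebesgue_tuple_opp n (B : set (RT n)) : measurable B ->
  lebesgue_tuple n (@tuple_opp n @^-1` B) = lebesgue_tuple n B.
Proof.
elim: n B => [|n IH] B mB.
  rewrite (_ : @tuple_opp 0 @^-1` B = B)//; apply/seteqP.
  by split=> t /=; rewrite [tuple_opp t]tuple0 [t]tuple0.
rewrite /= /lebesgue_cons /pushforward /= /product_measure1.
have mA : measurable (@Defs.cons_tuple R n @^-1` B).
  by rewrite -[X in measurable X]setTI; exact: measurable_cons_tuple.
rewrite -[RHS](@integralT_comp_involution _ RR R lebesgue_measure -%R) //.
- apply: eq_integral => x _ /=.
  rewrite -[RHS]IH; last exact: measurable_xsection.
  congr (lebesgue_tuple n _); apply/seteqP; split=> w /=; rewrite !xsectionE/= ;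
    rewrite /cons_tuple /= (_ : tuple_opp _ = [tuple of - x :: tuple_opp w])//; exact: val_inj.
- exact: opprK.
- by move=> C mC; exact: lebesgue_measureN.
Qed.

End TupleNegation.

Section Geometry.
Context {R : realType}.
Implicit Types d : nat.

Lemma dotpC d (x y : 'rV[R]_d) : dotp x y = dotp y x.
Proof. by apply: eq_bigr => i _; rewrite mulrC. Qed.

Lemma dotpDl d (x y z : 'rV[R]_d) : dotp (x + y) z = dotp x z + dotp y z.
Proof. by rewrite /dotp -big_split; apply: eq_bigr => i _; rewrite mxE mulrDl. Qed.

Lemma dotpZl d a (x z : 'rV[R]_d) : dotp (a *: x) z = a * dotp x z.
Proof. by rewrite /dotp mulr_sumr; apply: eq_bigr => i _; rewrite mxE mulrA. Qed.

Lemma dotpNl d (x z : 'rV[R]_d) : dotp (- x) z = - dotp x z.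
Proof. by rewrite -scaleN1r dotpZl mulN1r. Qed.

Lemma dotpDr d (x y z : 'rV[R]_d) : dotp z (x + y) = dotp z x + dotp z y.
Proof. by rewrite dotpC dotpDl !(dotpC z). Qed.

Lemma dotpZr d a (x z : 'rV[R]_d) : dotp z (a *: x) = a * dotp z x.
Proof. by rewrite dotpC dotpZl (dotpC z). Qed.

Lemma dotpNr d (x z : 'rV[R]_d) : dotp z (- x) = - dotp z x.
Proof. by rewrite dotpC dotpNl (dotpC z). Qed.

Lemma dotp_ge0 d (x : 'rV[R]_d) : 0 <= dotp x x.
Proof. by apply: sumr_ge0 => i _; rewrite -expr2 sqr_ge0. Qed.

Lemma dotp_eq0 d (x : 'rV[R]_d) : (dotp x x == 0) = (x == 0).
Proof.
apply/eqP/eqP => [|->]; last by rewrite /dotp big1// => i _; rewrite mxE mul0r.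
move=> H; apply/rowP => i; rewrite mxE.
have /(_ i isT)/eqP := psumr_eq0P (fun i _ => sqr_ge0 (x 0 i)) H.
by rewrite mulf_eq0 orbb => /eqP.
Qed.

Lemma enorm_ge0 d (x : 'rV[R]_d) : 0 <= enorm x.
Proof. exact: sqrtr_ge0. Qed.

Lemma enorm_eq0 d (x : 'rV[R]_d) : (enorm x == 0) = (x == 0).
Proof. by rewrite sqrtr_eq0 -dotp_eq0 eq_le dotp_ge0 andbT. Qed.

Lemma enormN d (x : 'rV[R]_d) : enorm (- x) = enorm x.
Proof. by rewrite /enorm dotpNl dotpNr opprK. Qed.

Lemma enorm_orthoB d (y z : 'rV[R]_d) : dotp y z = 0 ->
  enorm (y - z) = enorm (y + z).
Proof.
move=> yz; rewrite /enorm !(dotpDl, dotpDr, dotpNl, dotpNr) (dotpC z) yz.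
by congr Num.sqrt; ring.
Qed.

Lemma enorm_orthoD_gt0 d (y z : 'rV[R]_d) : y != 0 -> dotp y z = 0 ->
  0 < enorm (y + z).
Proof.
move=> y0 yz; rewrite lt0r enorm_ge0 andbT enorm_eq0; apply: contra y0 => /eqP E.
have : dotp y (y + z) = dotp y y by rewrite dotpDr yz addr0.
by rewrite -dotp_eq0 => <-; rewrite E -(scale0r y) dotpZr mul0r.
Qed.

(** Both vectors have the same set of frames, so [xget] makes the same choice; replacing y by -y
    then leaves the coordinates of the inner integral untouched. *)
Lemma frameN d (y : 'rV[R]_d) : frame (- y) = frame y.
Proof.
rewrite /frame; congr xget; apply/seteqP.
have E (A : 'M[R]_(d.-1, d)) : A *m (- y)^T = - (A *m y^T).
  by rewrite linearN /= mulmxN.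
split=> A /= [AA]; rewrite E => H; split=> //; last by rewrite H oppr0.
by apply: oppr_inj; rewrite H oppr0.
Qed.

Lemma dotp_frame d (y : 'rV[R]_d) w : dotp y (w *m frame y) = 0.
Proof.
have : frame y *m y^T = 0.
  (* If no frame exists, [xget] returns its default 0, which annihilates y too. *)
  rewrite /frame; case: xgetP => [A _ []//|_]; exact: mul0mx.
move=> /(congr1 (mulmx w)); rewrite mulmxA mulmx0 => /matrixP/(_ 0 0).
rewrite mxE [in X in _ = X]mxE => <-; apply: eq_bigr => i _.
by rewrite [in RHS]mxE mulrC mxE [in RHS]mxE.
Qed.

Lemma measurable_enorm_mulmx k d (M : 'M[R]_(k, d)) :
  measurable_fun [set: k.-tuple (measurableTypeR R)]
    (fun w => enorm (vec w *m M)).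
Proof.
apply: (@measurableT_comp _ _ _ _ _ _ (@Num.sqrt R)).
  by apply: continuous_measurable_fun; exact: sqrt_continuous.
apply: measurable_sum => i; apply: measurable_funM;
  under eq_fun do rewrite mxE;
  by apply: measurable_sum => j; under eq_fun do rewrite mxE;
     apply: measurable_funM => //; exact: measurable_tnth.
Qed.

Lemma measurable_ball_perp d (rad : R) (y : 'rV[R]_d) :
  measurable (ball_perp rad y).
Proof.
rewrite (_ : ball_perp rad y = (fun w => enorm (vec w *m frame y)) @^-1` `]-oo, rad]).
  rewrite -[X in measurable X]setTI; apply: measurable_enorm_mulmx => //.
by apply/seteqP; split => w; rewrite /= in_itv.
Qed.

Lemma measurable_ballR d (rad : R) : measurable (@ballR R d rad).
Proof.
rewrite (_ : ballR rad = (fun w => enorm (vec w *m 1%:M)) @^-1` `]-oo, rad]).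
  rewrite -[X in measurable X]setTI; apply: measurable_enorm_mulmx => //.
by apply/seteqP; split => w; rewrite /= in_itv /= mulmx1.
Qed.

End Geometry.

Section DeltaIntegral.
Context {R : realType}.
Variables (d : nat) (rad : R).
Implicit Types phi psi : 'rV[R]_d -> 'rV[R]_d -> R.

Lemma eq_int_delta phi psi :
  (forall y z, dotp y z = 0 -> phi y z = psi y z) ->
  int_delta rad phi = int_delta rad psi.
Proof.
move=> E; apply: eq_Rintegral => y _; congr (_ * _).
by apply: eq_Rintegral => w _; rewrite E// dotp_frame.
Qed.

Lemma int_delta_oppr phi :
  int_delta rad (fun y z => phi y (- z)) = int_delta rad phi.
Proof.
apply: eq_Rintegral => y _; congr (_ * fine _).
rewrite -[RHS](@integral_comp_involution _ _ R (lebesgue_tuple d.-1) (@tuple_opp R d.-1)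
  (@measurable_tuple_opp R d.-1) (@tuple_oppK R d.-1) (@lebesgue_tuple_opp R d.-1)).
  by apply: eq_integral => w _; rewrite vec_tuple_opp mulNmx.
by apply/seteqP; split => w; rewrite /ball_perp /= vec_tuple_opp mulNmx enormN.
Qed.

Lemma int_delta_oppl phi :
  int_delta rad (fun y z => phi (- y) z) = int_delta rad phi.
Proof.
apply: (congr1 fine).
rewrite -[RHS](@integral_comp_involution _ _ R (lebesgue_tuple d) (@tuple_opp R d)
  (@measurable_tuple_opp R d) (@tuple_oppK R d) (@lebesgue_tuple_opp R d)).
  apply: eq_integral => y _; rewrite vec_tuple_opp enormN /int_perp /ball_perp.
  by rewrite frameN.
by apply/seteqP; split => w; rewrite /ballR /= vec_tuple_opp enormN.
Qed.

End DeltaIntegral.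

(** * Positivity of finite combinations of delta integrals *)

Section NonnegativeCombination.
Context d (T : measurableType d) (R : realType).
Variables (mu : {measure set T -> \bar R}) (D : set T).
Hypothesis mD : measurable D.
Variables (I : finType) (a : I -> R) (f : I -> T -> R).
Hypothesis fint : forall i, mu.-integrable D (EFin \o f i).

Lemma integrable_lincomb :
  mu.-integrable D (EFin \o (fun x => \sum_i a i * f i x)).
Proof.
rewrite (_ : _ \o _ = fun x => (\sum_i (a i)%:E * (f i x)%:E)%E).
  by apply: integrable_sum => // i _; apply: integrableZl => //; exact: fint.
by apply/funext => x /=; rewrite -sumEFin.
Qed.

Lemma Rintegral_lincomb :
  \int[mu]_(x in D) (\sum_i a i * f i x) = \sum_i a i * \int[mu]_(x in D) f i x.
Proof.
rewrite /Rintegral; under eq_integral do rewrite -sumEFin.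
rewrite integral_sum//; last first.
  by move=> i; under eq_fun do rewrite EFinM; apply: integrableZl => //; exact: fint.
under eq_bigr => i _.
  under eq_integral do rewrite EFinM.
  rewrite integralZl//; last exact: fint.
  rewrite -[X in (_ * X)%E]fineK; last by apply: integrable_fin_num => //; exact: fint.
  rewrite -EFinM; over.
by rewrite sumEFin.
Qed.

Lemma Rintegral_ae_ge0 (g : T -> R) : mu.-integrable D (EFin \o g) ->
  {ae mu, forall x, D x -> 0 <= g x} -> 0 <= \int[mu]_(x in D) g x.
Proof.
move=> gint g0; have mg : measurable_fun D g.
  by apply/measurable_EFinP; exact: measurable_int gint.
rewrite (_ : \int[mu]_(x in D) g x = \int[mu]_(x in D) Num.max (g x) 0).
  by apply: Rintegral_ge0 => x _; rewrite le_max lexx orbT.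
congr fine; apply: ae_eq_integral => //.
- exact/measurable_EFinP.
- by apply/measurable_EFinP; exact: measurable_maxr.
- by apply: filterS g0 => x /= H /H g0; rewrite max_l.
Qed.

End NonnegativeCombination.

(** Linearity is used for the outer and for the inner integral. The inner integrals converge for
    almost every y only; as [I] is finite, the exceptional sets have a null union, and the outer
    integrand is nonnegative almost everywhere. *)
Lemma int_delta_lincomb_ge0 (R : realType) (d : nat) (rad : R) (I : finType)
    (a : I -> R) (phi : I -> 'rV[R]_d -> 'rV[R]_d -> R) :
  (forall i, delta_integrable rad (phi i)) ->
  (forall y z, y != 0 -> dotp y z = 0 -> 0 <= \sum_i a i * phi i y z) ->
  0 <= \sum_i a i * int_delta rad (phi i).
Proof.
move=> iphi phi0; have mB := @measurable_ballR R d rad.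
have iJ i := let: And3 _ h _ := iphi i in h.
rewrite -(Rintegral_lincomb mB a iJ).
apply: Rintegral_ae_ge0 => //; first exact: (integrable_lincomb mB a iJ).
have iP i := let: And3 h _ _ := iphi i in h.
have := filter_forall (ae_filter_ringOfSetsType _) iP.
apply: filterS => y H yB.
(* The sign hypothesis says nothing at y = 0; there the convention that the inverse of 0 is 0 kills
   the integrand. *)
have [y0|y0] := eqVneq (vec y) 0.
  rewrite big1// => i _; have /eqP -> : enorm (vec y) == 0 by rewrite enorm_eq0 y0.
  by rewrite invr0 mul0r mulr0.
under eq_bigr do rewrite mulrCA.
rewrite -mulr_sumr mulr_ge0 ?invr_ge0 ?enorm_ge0//.
rewrite -Rintegral_lincomb; [|exact: measurable_ball_perp|by move=> i; exact: H].
by apply: Rintegral_ge0 => w _; apply: phi0 => //; exact: dotp_frame.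
Qed.

Section ComplexParts.
Local Open Scope complex_scope.
Context {R : rcfType}.

Lemma Re_sum (I : Type) (s : seq I) (F : I -> R[i]) :
  complex.Re (\sum_(i <- s) F i) = \sum_(i <- s) complex.Re (F i).
Proof. by elim/big_rec2: _ => // i x y _ <-; case: (F i); case: y. Qed.

Lemma Im_sum (I : Type) (s : seq I) (F : I -> R[i]) :
  complex.Im (\sum_(i <- s) F i) = \sum_(i <- s) complex.Im (F i).
Proof. by elim/big_rec2: _ => // i x y _ <-; case: (F i); case: y. Qed.

Lemma Re_mul (x y : R[i]) : complex.Re (x * y) =
  complex.Re x * complex.Re y - complex.Im x * complex.Im y.
Proof. by case: x y => [a b] []. Qed.

Lemma Im_mul (x y : R[i]) : complex.Im (x * y) =
  complex.Re x * complex.Im y + complex.Im x * complex.Re y.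
Proof. by case: x y => [a b] []. Qed.

Lemma lec0_ReIm (x : R[i]) :
  (0 <= x) = (complex.Im x == 0) && (0 <= complex.Re x).
Proof. by rewrite lecE. Qed.

End ComplexParts.

Section KernelModes.
Local Open Scope complex_scope.
Context {R : realType}.
Variables (d : nat) (rad T : R) (b : R -> R -> R).
Hypothesis b_ge0 : forall x c : R, 0 < x -> 0 <= c <= 1 -> 0 <= b x c.
Implicit Types (y z : 'rV[R]_d) (l m : 'rV[int]_d).

(** Changing the sign of y exchanges y + z and y - z up to sign. By orthogonality they have the same
    length, and [b] sees only this length and the absolute value of a scalar product. *)
Lemma kernel_tilde_oppl y z : dotp y z = 0 ->
  kernel_tilde b (- y) z = kernel_tilde b y z.
Proof.
move=> yz; rewrite /kernel_tilde /collision_kernel.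
have -> : - y + z = - (y - z) by rewrite opprB addrC.
have -> : - y - z = - (y + z) by rewrite opprD.
rewrite !enormN enorm_orthoB// !(dotpNl, dotpNr, dotpZr) mulrN opprK.
by rewrite (dotpC (y - z)).
Qed.

Lemma kernel_tilde_oppr y z : dotp y z = 0 ->
  kernel_tilde b y (- z) = kernel_tilde b y z.
Proof.
move=> yz; rewrite /kernel_tilde /collision_kernel opprK enorm_orthoB//.
by rewrite !dotpZr (dotpC (y - z)).
Qed.

Lemma cauchy_schwarz_dotp y z : `|dotp y z| <= enorm y * enorm z.
Proof.
have [->|z0] := eqVneq z 0.
  by rewrite -(scale0r 0) dotpZr mul0r normr0 mulr_ge0 ?enorm_ge0.
have zz : 0 < dotp z z by rewrite lt0r dotp_eq0 z0 dotp_ge0.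
rewrite /enorm -sqrtrM ?dotp_ge0// -sqrtr_sqr ler_wsqrtr//.
have := dotp_ge0 (dotp z z *: y - dotp y z *: z).
rewrite !(dotpDl, dotpDr, dotpNl, dotpNr, dotpZl, dotpZr) (dotpC z y).
rewrite (_ : _ + _ = dotp z z * (dotp y y * dotp z z - dotp y z ^+ 2)); last by ring.
by rewrite pmulr_rge0// subr_ge0.
Qed.

(** Nonnegativity of [b] is assumed only for positive speeds and cosines in [0, 1]. Orthogonality
    with y nonzero makes y + z and y - z nonzero, and Cauchy-Schwarz with a unit vector bounds the
    cosine by 1. *)
Lemma kernel_tilde_ge0 y z : y != 0 -> dotp y z = 0 -> 0 <= kernel_tilde b y z.
Proof.
move=> y0 yz; have yzD := enorm_orthoD_gt0 y0 yz.
rewrite /kernel_tilde mulr_ge0 ?mulr_ge0 ?exprn_ge0//; last exact/exprz_ge0/ltW.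
apply: b_ge0 => //; rewrite divr_ge0 ?(ltW yzD)//= ler_pdivrMr// mul1r.
apply: le_trans (cauchy_schwarz_dotp _ _) _.
rewrite ler_piMr ?enorm_ge0// /enorm dotpZl dotpZr -/(enorm _).
have e0 : 0 < enorm (y - z) by rewrite enorm_orthoB.
rewrite -[X in _ * (_ * X)]sqr_sqrtr ?dotp_ge0// -/(enorm _).
by rewrite (_ : _ * _ = 1) ?sqrtr1//; field; rewrite gt_eqF.
Qed.

Lemma fourier_opp l y : fourier T (- l) y = fourier T l (- y).
Proof.
rewrite /fourier; congr (_ +i* _); congr (_ (_ * _));
  by apply: eq_bigr => i _; rewrite !mxE rmorphN mulrN mulNr.
Qed.

Lemma mode_integrand_oppl l m y z : dotp y z = 0 ->
  mode_integrand T b (- l) m y z = mode_integrand T b l m (- y) z.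
Proof. by move=> yz; rewrite /mode_integrand kernel_tilde_oppl// fourier_opp. Qed.

Lemma mode_integrand_oppr l m y z : dotp y z = 0 ->
  mode_integrand T b l (- m) y z = mode_integrand T b l m y (- z).
Proof. by move=> yz; rewrite /mode_integrand kernel_tilde_oppr// fourier_opp. Qed.

Lemma kernel_mode_oppl l m :
  kernel_mode rad T b (- l) m = kernel_mode rad T b l m.
Proof.
have E (p : R[i] -> R) :
    int_delta rad (fun y z => p (mode_integrand T b (- l) m y z)) =
    int_delta rad (fun y z => p (mode_integrand T b l m y z)).
  transitivity (int_delta rad (fun y z => p (mode_integrand T b l m (- y) z))).
    by apply: eq_int_delta => y z yz; rewrite mode_integrand_oppl.
  exact: (int_delta_oppl rad (fun y z => p (mode_integrand T b l m y z))).
by rewrite /kernel_mode !E.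
Qed.

Lemma kernel_mode_oppr l m :
  kernel_mode rad T b l (- m) = kernel_mode rad T b l m.
Proof.
have E (p : R[i] -> R) :
    int_delta rad (fun y z => p (mode_integrand T b l (- m) y z)) =
    int_delta rad (fun y z => p (mode_integrand T b l m y z)).
  transitivity (int_delta rad (fun y z => p (mode_integrand T b l m y (- z)))).
    by apply: eq_int_delta => y z yz; rewrite mode_integrand_oppr.
  exact: (int_delta_oppr rad (fun y z => p (mode_integrand T b l m y z))).
by rewrite /kernel_mode !E.
Qed.

Hypothesis conv : modes_converge d rad T b.

(** The kernel is a nonnegative real factor of each integrand, so the sign passes from the
    exponentials to the modes. Indexing by [I * bool] turns the complex combination into real ones,
    to which [int_delta_lincomb_ge0] applies. *)
Lemma kernel_mode_lincomb_ge0 (I : finType) (c : I -> R[i])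
    (l m : I -> 'rV[int]_d) :
  (forall y z, y != 0 -> dotp y z = 0 ->
     0 <= \sum_i c i * (fourier T (l i) y * fourier T (m i) z)) ->
  0 <= \sum_i c i * kernel_mode rad T b (l i) (m i).
Proof.
move=> H0; have H y z : y != 0 -> dotp y z = 0 ->
    0 <= \sum_i c i * mode_integrand T b (l i) (m i) y z.
  move=> y0 yz; rewrite /mode_integrand.
  under eq_bigr do rewrite -mulrA mulrCA.
  rewrite -mulr_sumr mulr_ge0 ?H0// lec0_ReIm /= eqxx.
  exact: kernel_tilde_ge0.
pose phi (ib : I * bool) y z := let w := mode_integrand T b (l ib.1) (m ib.1) y z in
  if ib.2 then complex.Im w else complex.Re w.
have phiF i y z : phi (i, false) y z =
  complex.Re (mode_integrand T b (l i) (m i) y z) by [].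
have phiT i y z : phi (i, true) y z =
  complex.Im (mode_integrand T b (l i) (m i) y z) by [].
have kE i : kernel_mode rad T b (l i) (m i) =
  int_delta rad (phi (i, false)) +i* int_delta rad (phi (i, true)) by [].
have iphi ib : delta_integrable rad (phi ib).
  by rewrite /phi; case: ib.2; have [] := conv (l ib.1) (m ib.1).
have split (a : I * bool -> R) (F : I * bool -> R) :
    \sum_ib a ib * F ib =
    \sum_i (a (i, false) * F (i, false) + a (i, true) * F (i, true)).
  rewrite (eq_bigr (fun ib => a (ib.1, ib.2) * F (ib.1, ib.2))); last by case.
  rewrite -(pair_bigA _ (fun i c => a (i, c) * F (i, c))) /=.
  by apply: eq_bigr => i _; rewrite big_bool addrC.
pose aR (ib : I * bool) := if ib.2 then - complex.Im (c ib.1) else complex.Re (c ib.1).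
(* Taking [s] equal to 1 and to -1 gives two opposite inequalities, which force the imaginary part
   to be 0. *)
pose aI s (ib : I * bool) : R :=
  s * (if ib.2 then complex.Re (c ib.1) else complex.Im (c ib.1)).
have PR : 0 <= \sum_ib aR ib * int_delta rad (phi ib).
  apply: int_delta_lincomb_ge0 => // y z y0 yz.
  have := H y z y0 yz; rewrite lec0_ReIm => /andP[_]; rewrite Re_sum => h.
  rewrite split; apply: le_trans h _; rewrite le_eqVlt; apply/orP; left; apply/eqP.
  apply: eq_bigr => i _; rewrite phiF phiT.
  by move: (mode_integrand _ _ _ _ _ _) => u; rewrite Re_mul /aR /=; ring.
have PI s : 0 <= \sum_ib aI s ib * int_delta rad (phi ib).
  apply: int_delta_lincomb_ge0 => // y z y0 yz.
  have := H y z y0 yz; rewrite lec0_ReIm => /andP[/eqP]; rewrite Im_sum => h _.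
  rewrite split (_ : \sum_i _ = s * \sum_i
    complex.Im (c i * mode_integrand T b (l i) (m i) y z)).
    by rewrite h mulr0.
  rewrite mulr_sumr; apply: eq_bigr => i _; rewrite phiF phiT.
  by move: (mode_integrand _ _ _ _ _ _) => u; rewrite Im_mul /aI /=; ring.
rewrite lec0_ReIm Re_sum Im_sum; apply/andP; split.
- have := PI 1; have := PI (-1); rewrite !split.
  have E s : \sum_i (aI s (i, false) * int_delta rad (phi (i, false)) +
       aI s (i, true) * int_delta rad (phi (i, true))) =
     s * \sum_i complex.Im (c i * kernel_mode rad T b (l i) (m i)).
    rewrite mulr_sumr; apply: eq_bigr => i _; rewrite kE.
    by move: (int_delta _ _) (int_delta _ _) => v w; rewrite Im_mul /aI /=; ring.
  rewrite !E; lra.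
- move: PR; rewrite split => h; apply: le_trans h _.
  rewrite le_eqVlt; apply/orP; left; apply/eqP.
  apply: eq_bigr => i _; rewrite kE.
  by move: (int_delta _ _) (int_delta _ _) => v w; rewrite Re_mul /aR /=; ring.
Qed.

End KernelModes.

(** * The modified Jackson kernel *)

Section Cis.
Local Open Scope complex_scope.
Context {R : realType}.
Implicit Types x y : R.

Definition cis x : R[i] := cos x +i* sin x.

Lemma cis0 : cis 0 = 1.
Proof. by rewrite /cis cos0 sin0. Qed.

Lemma cisD x y : cis (x + y) = cis x * cis y.
Proof.
rewrite /cis cosD sinD; apply/eqP; rewrite eq_complex /=.
by apply/andP; split; apply/eqP; ring.
Qed.

Lemma cis_sum (I : Type) (s : seq I) (f : I -> R) :
  cis (\sum_(i <- s) f i) = \prod_(i <- s) cis (f i).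
Proof. by apply: (big_morph cis cisD cis0). Qed.

Lemma conj_real x : Num.conj (x%:C) = x%:C :> R[i].
Proof. exact: conjc_real. Qed.

Lemma conjc_cis x : Num.conj (cis x) = cis (- x).
Proof. by rewrite /cis cosN sinN. Qed.

End Cis.

Section Jackson.
Local Open Scope complex_scope.
Context {R : realType}.
Variable n : nat.
Hypothesis n_gt0 : (0 < n)%N.

Let x : R := pi / n.+1%:R.

Let w (j : nat) : R := sin (x * j%:R).

Let sinx_gt0 : 0 < sin x.
Proof.
apply: sin_gt0_pi; rewrite divr_gt0 ?pi_gt0//=.
by rewrite ltr_pdivrMr// ltr_pMr ?pi_gt0// ltr1n ltnS.
Qed.

(** Twice a product of sines is cos c - cos (2 x j + c), and multiplying the second cosine by 2 sin
    x makes the sum over j telescope. *)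
Lemma sum_sin_sin (m : nat) (c : R) :
  2 * sin x * \sum_(j < m) 2 * (w j * sin (x * j%:R + c)) =
  2 * m%:R * sin x * cos c - sin (2 * x * m%:R - x + c) + sin (c - x).
Proof.
elim: m => [|m IH]; first by rewrite big_ord0 !mulr0 !mul0r !sub0r (addrC (- x)) addNr.
rewrite big_ord_recr /= mulrDr IH /w -[m.+1%:R]natr1.
set u := x * m%:R; set v := u + c.
have -> : 2 * x * (m%:R + 1) - x + c = v + u + x by rewrite /v /u; ring.
have -> : 2 * x * m%:R - x + c = v + u - x by rewrite /v /u; ring.
have -> : cos c = cos (v - u) by rewrite /v; congr cos; ring.
rewrite (sinD (v + u) x) (sinB (v + u) x) (cosD v u) (cosB v u); ring.
Qed.

Lemma jackson1_nat (be : nat) : (be <= n)%N ->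
  @jackson1 R n be%:Z * n.+1%:R = \sum_(j < n.+1 - be) 2 * (w j * w (j + be)).
Proof.
move=> bn; rewrite /jackson1 (_ : `|be%:Z| = be%:Z)// divfK ?pnatr_eq0//.
apply: (@mulfI _ (2 * sin x)); first by rewrite mulf_neq0// gt_eqF.
under [in RHS]eq_bigr do rewrite {2}/w natrD mulrDr.
rewrite sum_sin_sin -/x natrB ?(leqW bn)//.
have -> : be%:~R = be%:R :> R by [].
set c := x * be%:R; set N : R := n.+1%:R.
have xN : x * N = pi by rewrite /x mulrVK// unitfE pnatr_eq0.
(* The choice x = pi / (n + 1) enters here: the upper end of the telescoping sum folds back to -(c +
   x), and the two end terms add up to 2 sin c cos x, the source of the cotangent. *)
have -> : 2 * x * (N - be%:R) - x + c = pi *+ 2 - (c + x).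
  by rewrite /c mulr2n -xN; ring.
rewrite -[pi *+ 2 - _]addrC sinD2pi sinN (sinD c x) (sinB c x).
by field; rewrite gt_eqF.
Qed.

Lemma jackson1N (be : int) : @jackson1 R n (- be) = @jackson1 R n be.
Proof. by rewrite /jackson1 normrN. Qed.

(** The index [a] stands for the frequency a - n, so i - j = a - n is written without subtraction as
    i + n = a + j. Negative frequencies reduce to positive ones by exchanging i and j. *)
Lemma jackson1_autocorrelation (a : 'I_(2 * n).+1) :
  @jackson1 R n (a%:Z - n%:Z) * n.+1%:R =
  2 * \sum_(i < n.+1) \sum_(j < n.+1 | (i + n == a + j)%N) w i * w j.
Proof.
have key (be : nat) : (be <= n)%N -> \sum_(j < n.+1 - be) 2 * (w j * w (j + be)) =
    2 * \sum_(j < n.+1) \sum_(i < n.+1 | (i == j + be :> nat)%N) w i * w j.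
  move=> bn; rewrite mulr_sumr.
  rewrite (big_ord_widen n.+1 (fun j => 2 * (w j * w (j + be)))) ?leq_subr//.
  rewrite big_mkcond; apply: eq_bigr => j _ /=.
  case: ifPn => jb.
    have jb' : (j + be < n.+1)%N by lia.
    rewrite (bigD1 (Ordinal jb'))//= big1 ?addr0; first by rewrite (mulrC (w j)).
    by move=> i /andP[/eqP ij /eqP]; case; apply: val_inj.
  rewrite big1 ?mulr0// => i /eqP ij; have := ltn_ord i; lia.
have [na|an] := leqP n a.
  have -> : a%:Z - n%:Z = (a - n)%N%:Z by lia.
  have an2 := ltn_ord a.
  rewrite jackson1_nat; last by lia.
  rewrite key; last by lia.
  rewrite [in RHS](exchange_big_dep predT)//=; congr (_ * _); apply: eq_bigr => j _.
  by rewrite [in RHS]big_mkcond [LHS]big_mkcond; apply: eq_bigr => i _;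
    congr (if _ then _ else _); lia.
have -> : a%:Z - n%:Z = - (n - a)%N%:Z by lia.
rewrite jackson1N jackson1_nat ?leq_subr// key ?leq_subr//.
congr (_ * _); apply: eq_bigr => j _.
rewrite [in RHS]big_mkcond [LHS]big_mkcond; apply: eq_bigr => i _.
rewrite mulrC; congr (if _ then _ else _); lia.
Qed.

(** A Fejér-Riesz factorization: the sum is 2 / (n + 1) times the squared modulus of Z, the
    trigonometric polynomial with the sines as coefficients. *)
Lemma jackson1_kernel_ge0 (t : R) :
  0 <= \sum_(a < (2 * n).+1)
    (@jackson1 R n (a%:Z - n%:Z))%:C * cis ((a%:Z - n%:Z)%:~R * t).
Proof.
pose Z := \sum_(i < n.+1) (w i)%:C * cis (i%:R * t).
have -> : \sum_(a < (2 * n).+1)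
    (@jackson1 R n (a%:Z - n%:Z))%:C * cis ((a%:Z - n%:Z)%:~R * t) =
    (2 / n.+1%:R)%:C * (Z * Num.conj Z).
  pose F (i j : 'I_n.+1) : R[i] := (w i * w j)%:C * cis ((i%:R - j%:R) * t).
  transitivity ((2 / n.+1%:R)%:C * \sum_i \sum_j F i j); last first.
    have -> : Num.conj Z = \sum_(i < n.+1) (w i)%:C * cis (- (i%:R * t)).
      rewrite /Z rmorph_sum; apply: eq_bigr => i _.
      by rewrite -conjc_cis -[(w i)%:C in RHS]conj_real -rmorphM.
    congr (_ * _); rewrite /Z mulr_suml; apply: eq_bigr => i _.
    rewrite mulr_sumr; apply: eq_bigr => j _.
    by rewrite /F mulrBl cisD rmorphM; ring.
  transitivity (\sum_(a < (2 * n).+1) (2 / n.+1%:R)%:C *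
    \sum_(i < n.+1) \sum_(j < n.+1 | (i + n == a + j)%N) F i j); last first.
    rewrite -mulr_sumr; congr (_ * _); rewrite exchange_big; apply: eq_bigr => i _.
    rewrite (exchange_big_dep predT)//=; apply: eq_bigr => j _.
    have h : (i + n - j < (2 * n).+1)%N by have := ltn_ord i; lia.
    rewrite (bigD1 (Ordinal h)) /=; last by have := ltn_ord j; lia.
    rewrite big1 ?addr0// => a /andP[/eqP E /eqP]; case; apply: val_inj => /=.
    by have := ltn_ord j; lia.
  apply: eq_bigr => a _.
  have -> : @jackson1 R n (a%:Z - n%:Z) =
    2 / n.+1%:R * \sum_(i < n.+1) \sum_(j < n.+1 | (i + n == a + j)%N) w i * w j.
    apply: (@mulIf _ n.+1%:R); first by rewrite pnatr_eq0.
    by rewrite jackson1_autocorrelation [RHS]mulrAC divfK ?pnatr_eq0.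
  rewrite rmorphM -mulrA; congr (_ * _); rewrite rmorph_sum mulr_suml.
  apply: eq_bigr => i _; rewrite rmorph_sum mulr_suml; apply: eq_bigr => j /eqP E.
  rewrite /F; congr (_ * cis (_ * _)).
  have -> : a%:Z - n%:Z = i%:Z - j%:Z by lia.
  by rewrite rmorphB.
rewrite mulr_ge0 ?mul_conjC_ge0//.
by rewrite lecE /= eqxx divr_ge0.
Qed.

End Jackson.

(** * The method in physical space *)

(* The grid X and the mode set K are both identified with (Z/N)^d. *)
Definition gridG (d n : nat) : Type := {ffun 'I_d -> 'I_(2 * n).+1}.
HB.instance Definition _ d n := Finite.on (gridG d n).
HB.instance Definition _ d n := GRing.Zmodule.on (gridG d n).

(** * Fourier analysis on a finite abelian group *)

Section BicharacterTransform.
Variables (G : finZmodType) (K : numFieldType) (chi : G -> G -> K).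
Hypothesis chiDl : forall k l g, chi (k + l) g = chi k g * chi l g.
Hypothesis chiDr : forall k g h, chi k (g + h) = chi k g * chi k h.
Hypothesis chi0l : forall g, chi 0 g = 1.
Hypothesis chi0r : forall k, chi k 0 = 1.
Hypothesis chi_sep : forall k, k != 0 -> exists g, chi k g != 1.
Hypothesis chiC : forall k g, chi k g = chi g k.

Let G0 : #|G|%:R != 0 :> K.
Proof. by rewrite pnatr_eq0 -lt0n; apply/card_gt0P; exists 0. Qed.

Lemma chiNr k g : chi k (- g) = chi (- k) g.
Proof.
have u : chi k g * chi k (- g) = 1 by rewrite -chiDr subrr chi0r.
have v : chi k g * chi (- k) g = 1 by rewrite -chiDl subrr chi0l.
have : chi k g != 0 by apply: contra_eq_neq u => ->; rewrite mul0r eq_sym oner_neq0.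
by move/mulfI; apply; rewrite u v.
Qed.

(** Translating by the element g0 given by [chi_sep] multiplies the sum by [chi k g0], which differs
    from 1. *)
Lemma sum_chi k : \sum_g chi k g = #|G|%:R * (k == 0)%:R.
Proof.
have [->|/chi_sep[g0 g01]] := eqVneq k 0.
  by under eq_bigr do rewrite chi0l; rewrite sumr_const mulr1.
rewrite mulr0; apply/eqP.
have : chi k g0 * (\sum_g chi k g) = \sum_g chi k g.
  rewrite mulr_sumr [RHS](reindex_inj (addrI g0)) /=.
  by apply: eq_bigr => g _; rewrite chiDr.
move=> /eqP; rewrite -subr_eq0 -{2}[\sum_g _]mul1r -mulrBl mulf_eq0 subr_eq0.
by rewrite (negbTE g01).
Qed.

Lemma sum_chiN k l : \sum_g chi k (- g) * chi l g = #|G|%:R * (k == l)%:R.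
Proof.
under eq_bigr do rewrite chiNr -chiDl.
by rewrite sum_chi addrC subr_eq0 (eq_sym l).
Qed.

Lemma fourier_inversion (f : G -> K) g :
  \sum_k (#|G|%:R^-1 * \sum_j f j * chi (- k) j) * chi k g = f g.
Proof.
under eq_bigr do rewrite -mulrA mulr_suml.
rewrite -mulr_sumr exchange_big /= (bigD1 g) //= [X in _ + X]big1 ?addr0.
  under eq_bigr do rewrite -mulrA -chiDl addNr chi0l mulr1.
  by rewrite sumr_const -[f g *+ _]mulr_natl mulKf.
move=> j jg; under eq_bigr do rewrite -mulrA -chiNr (chiC _ (- j)) mulrC.
rewrite -mulr_suml.
under eq_bigr do rewrite (chiC _ g) -chiDl.
by rewrite sum_chi addrC subr_eq0 (eq_sym g) (negbTE jg) mulr0 mul0r.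
Qed.

Variable B : G -> G -> K.

(** The inverse discrete Fourier transform of [B] in both variables. *)
Definition collision_coeff p q : K :=
  (#|G|%:R ^+ 2)^-1 * \sum_l \sum_m B l m * (chi l (- p) * chi m (- q)).

Lemma collision_coeff_transform l m :
  \sum_p \sum_q collision_coeff p q * (chi l p * chi m q) = B l m.
Proof.
rewrite /collision_coeff.
have E p q : ((#|G|%:R ^+ 2)^-1 * \sum_l' \sum_m' B l' m' * (chi l' (- p) * chi m' (- q)))
   * (chi l p * chi m q) =
   (#|G|%:R ^+ 2)^-1 * \sum_l' \sum_m' B l' m' * (chi l' (- p) * chi l p) * (chi m' (- q) * chi m q).
  rewrite -mulrA mulr_suml; congr (_ * _); apply: eq_bigr => l' _.
  by rewrite mulr_suml; apply: eq_bigr => m' _; ring.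
under eq_bigr do under eq_bigr do rewrite E.
under eq_bigr do rewrite -mulr_sumr.
rewrite -mulr_sumr.
have -> : \sum_p \sum_q \sum_l' \sum_m'
    B l' m' * (chi l' (- p) * chi l p) * (chi m' (- q) * chi m q) =
  \sum_l' \sum_m' B l' m' * (\sum_p chi l' (- p) * chi l p) *
    (\sum_q chi m' (- q) * chi m q).
  transitivity (\sum_p \sum_l' \sum_m' \sum_q
    B l' m' * (chi l' (- p) * chi l p) * (chi m' (- q) * chi m q)).
    apply: eq_bigr => p _; rewrite exchange_big; apply: eq_bigr => l' _.
    by rewrite exchange_big.
  rewrite exchange_big; apply: eq_bigr => l' _.
  rewrite exchange_big; apply: eq_bigr => m' _.
  rewrite -mulrA mulr_suml mulr_sumr; apply: eq_bigr => p _.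
  by rewrite !mulr_sumr; apply: eq_bigr => q _; ring.
rewrite (bigD1 l)//= (bigD1 m)//= !sum_chiN !eqxx.
rewrite [X in _ + X + _]big1 ?addr0; last first.
  by move=> m' m'm; rewrite (sum_chiN m') (negbTE m'm) !mulr0.
rewrite [X in _ + X]big1 ?addr0; last first.
  move=> l' l'l; rewrite big1// => m' _.
  by rewrite (sum_chiN l') (negbTE l'l) !mulr0 mul0r.
by rewrite !mulr1; field.
Qed.

Lemma collision_coeff_oppl : (forall l m, B (- l) m = B l m) ->
  forall p q, collision_coeff (- p) q = collision_coeff p q.
Proof.
move=> BN p q; rewrite /collision_coeff; congr (_ * _).
rewrite (reindex_inj oppr_inj); apply: eq_bigr => l _; apply: eq_bigr => m _.
by rewrite BN chiNr !opprK chiNr.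
Qed.

Lemma collision_coeff_oppr : (forall l m, B l (- m) = B l m) ->
  forall p q, collision_coeff p (- q) = collision_coeff p q.
Proof.
move=> BN p q; rewrite /collision_coeff; congr (_ * _).
apply: eq_bigr => l _; rewrite (reindex_inj oppr_inj); apply: eq_bigr => m _.
by rewrite BN (chiNr (- m)) !opprK (chiNr m).
Qed.

(* The Fourier-side quadratic form becomes, at the grid points, the collision
   sum with the pair of velocities [g], [g + p + q] going to [g + p], [g + q]. *)
Lemma collision_fourier (c : G -> K) g (F := fun j => \sum_k c k * chi k j) :
  \sum_k (\sum_l \sum_m (l + m == k)%:R * (B l m - B m m) * c l * c m) * chi k g
  = collision collision_coeff F F g.
Proof.
transitivity (\sum_l \sum_m (B l m - B m m) * c l * c m * (chi l g * chi m g)).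
  under eq_bigr do rewrite mulr_suml.
  rewrite exchange_big; apply: eq_bigr => l _ /=.
  under eq_bigr do rewrite mulr_suml.
  rewrite exchange_big; apply: eq_bigr => m _ /=.
  rewrite (bigD1 (l + m))//= eqxx big1 ?addr0; first by rewrite mul1r chiDl.
  by move=> k; rewrite eq_sym => /negbTE ->; rewrite !mul0r.
have FD j h : F (j + h) = \sum_l c l * chi l j * chi l h.
  by apply: eq_bigr => l _; rewrite chiDr mulrA.
(* In the loss term both shifts fall on the mode m. Summed against the coefficients, the two
   products of characters therefore give [B l m] and [B m m]. *)
have E p q : F (g + p) * F (g + q) - F g * F (g + p + q) =
    \sum_l \sum_m (c l * c m * (chi l g * chi m g)) *
      (chi l p * chi m q - chi m p * chi m q).
  rewrite -addrA !FD /F !mulr_suml -sumrB; apply: eq_bigr => l _.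
  rewrite !mulr_sumr -sumrB; apply: eq_bigr => m _; rewrite chiDr; ring.
rewrite /collision; under [RHS]eq_bigr do under eq_bigr do rewrite E mulr_sumr.
transitivity (\sum_l \sum_m \sum_p \sum_q collision_coeff p q *
   (c l * c m * (chi l g * chi m g) * (chi l p * chi m q - chi m p * chi m q))).
  apply: eq_bigr => l _; apply: eq_bigr => m _.
  rewrite -(collision_coeff_transform l m) -{1}(collision_coeff_transform m m).
  rewrite -sumrB !mulr_suml; apply: eq_bigr => p _.
  by rewrite -sumrB !mulr_suml; apply: eq_bigr => q _; ring.
under [RHS]eq_bigr do rewrite exchange_big /=.
rewrite [RHS]exchange_big /=; apply: eq_bigr => l _.
under [RHS]eq_bigr do under eq_bigr do rewrite mulr_sumr.
under [RHS]eq_bigr do rewrite exchange_big /=.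
by rewrite [RHS]exchange_big.
Qed.

End BicharacterTransform.

(** * Residues modulo N and roots of unity *)

Section SymmetricResidue.
Variable n : nat.
Local Notation N := (2 * n).+1.

Lemma smod1P (z : int) : exists q : int, z = smod1 n z + q * N%:Z.
Proof.
exists ((z + n%:Z) %/ N%:Z)%Z; have := divz_eq (z + n%:Z) N%:Z.
rewrite /smod1; lia.
Qed.

Lemma smod1_bound (z : int) : - n%:Z <= smod1 n z <= n%:Z.
Proof.
have := modz_ge0 (z + n%:Z) (isT : N%:Z != 0).
have := ltz_pmod (z + n%:Z) (isT : 0 < N%:Z).
rewrite /smod1; lia.
Qed.

(** The source of uniqueness for symmetric residues: two integers in [-n, n] differ by at most 2n <
    N. *)
Lemma mulN_small (x q : int) : x = q * N%:Z -> - N%:Z < x < N%:Z -> x = 0.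
Proof. move=> ->; case: (ltrgtP q 0) => [q0|q0|->]; nia. Qed.

Lemma smod1_unique (z z' q : int) : z' = z + q * N%:Z ->
  - n%:Z <= z <= n%:Z -> smod1 n z' = z.
Proof.
move=> E zb; have [q' E'] := smod1P z'; have := smod1_bound z'.
move=> b'; have : smod1 n z' - z = (q - q') * N%:Z by rewrite mulrBl; lia.
move=> /mulN_small; lia.
Qed.

Lemma smod1_small (z : int) : - n%:Z <= z <= n%:Z -> smod1 n z = z.
Proof. by apply: (@smod1_unique _ _ 0); rewrite mul0r addr0. Qed.

End SymmetricResidue.

Section RootOfUnity.
Local Open Scope complex_scope.
Context {R : realType}.
Variable n : nat.
Local Notation N := (2 * n).+1.

Definition zeta_exp (z : int) : R[i] := cis (2 * pi / N%:R * z%:~R).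

Lemma zeta_expD x y : zeta_exp (x + y) = zeta_exp x * zeta_exp y.
Proof. by rewrite /zeta_exp rmorphD mulrDr cisD. Qed.

Lemma zeta_exp0 : zeta_exp 0 = 1.
Proof. by rewrite /zeta_exp mulr0 cis0. Qed.

Lemma zeta_exp_sum (I : Type) (s : seq I) (f : I -> int) :
  zeta_exp (\sum_(i <- s) f i) = \prod_(i <- s) zeta_exp (f i).
Proof. exact: (big_morph zeta_exp zeta_expD zeta_exp0). Qed.

Lemma zeta_exp_mulN_nat (q : nat) : zeta_exp (q%:Z * N%:Z) = 1.
Proof.
elim: q => [|q IH]; first by rewrite mul0r zeta_exp0.
rewrite -addn1 PoszD mulrDl zeta_expD IH mul1r mul1r /zeta_exp.
rewrite (_ : _ * _ = pi *+ 2).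
  by rewrite /cis -[pi *+ 2]add0r cosD2pi sinD2pi cos0 sin0.
by rewrite mulrVK ?unitfE ?pnatr_eq0// mulr_natl.
Qed.

Lemma zeta_exp_mulN (q : int) : zeta_exp (q * N%:Z) = 1.
Proof.
case: q => q; first exact: zeta_exp_mulN_nat.
have := zeta_expD (Negz q * N%:Z) (q.+1%:Z * N%:Z).
by rewrite zeta_exp_mulN_nat mulr1 -mulrDl NegzE addNr mul0r zeta_exp0.
Qed.

Lemma zeta_exp_neq1 (z : int) : 0 < z < N%:Z -> zeta_exp z != 1.
Proof.
move=> /andP[z0 zN]; rewrite eq_complex /= negb_and; apply/orP; left.
(* Half of the angle: it lies strictly between 0 and pi, so the real part 1 - 2 sin^2 u is less than
   1. *)
set u : R := pi * z%:~R / N%:R.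
have u0 : 0 < u by rewrite divr_gt0 ?mulr_gt0 ?pi_gt0 ?ltr0z.
have upi : u < pi.
  rewrite /u ltr_pdivrMr// ltr_pM2l ?pi_gt0//.
  by rewrite (_ : N%:R = N%:Z%:~R)// ltr_int.
have s0 : 0 < sin u by apply: sin_gt0_pi; rewrite u0.
have -> : 2 * pi / N%:R * z%:~R = u + u by rewrite /u; ring.
rewrite cosD -!expr2 cos2sin2.
by apply/eqP => E; have := mulr_gt0 s0 s0; nra.
Qed.

End RootOfUnity.

(** * The grid and the modes as the group (Z/N)^d *)

Section Grid.
Local Open Scope complex_scope.
Context {R : realType}.
Variables (d n : nat) (T : R).
Local Notation N := (2 * n).+1.
Local Notation G := (gridG d n).
Implicit Types (g h k l m : G).

Definition symrep g : 'rV[int]_d := \row_i smod1 n (g i)%:Z.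

Definition grid_point g : 'rV[R]_d := hstep n T *: map_mx (fun a : int => a%:~R) (symrep g).

Definition grid_char l g : R[i] := fourier T (symrep l) (grid_point g).

(** [gridK] reads a vector a as a - (n, ..., n), whereas [symrep] sends the class 0 to the frequency
    0, as the group law requires. Translation by [off] passes between the two labellings. *)
Let off : G := [ffun => inord n].

Let symrep_shift g : \row_i (((g + off)%R i)%:Z - n%:Z) = symrep g.
Proof.
apply/rowP => i; rewrite !mxE /smod1 ffunE /= ffunE /= inordK; last by lia.
by rewrite -PoszD modz_nat.
Qed.

Lemma sum_gridK (V : nmodType) (phi : 'rV[int]_d -> V) :
  \sum_(k <- gridK d n) phi k = \sum_(g : G) phi (symrep g).
Proof.
rewrite /gridK big_image /=.
have inj : injective (fun g : G => g + off : {ffun 'I_d -> 'I_N}) by exact: addIr.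
by rewrite (reindex_inj inj) /=; apply: eq_bigr => g _; rewrite -symrep_shift.
Qed.

Lemma sum_gridX (V : nmodType) (phi : 'rV[R]_d -> V) :
  \sum_(r <- gridX d n T) phi r = \sum_(g : G) phi (grid_point g).
Proof.
rewrite /gridX big_map.
exact: (sum_gridK (fun v => phi (_ *: map_mx (fun a : int => a%:~R) v))).
Qed.

Lemma symrep_gridK g : symrep g \in gridK d n.
Proof.
apply/mapP; exists (g + off : G); first by rewrite mem_enum.
by rewrite symrep_shift.
Qed.

Lemma gridX_grid_point r : r \in gridX d n T -> exists g, r = grid_point g.
Proof.
move=> /mapP[k /mapP[a _ ->] ->]; exists ((a : G) - off).
by rewrite /grid_point -symrep_shift subrK.
Qed.

Lemma symrepD k l i : exists q : int,
  symrep (k + l) 0 i = symrep k 0 i + symrep l 0 i + q * N%:Z.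
Proof.
rewrite !mxE ffunE /=.
have [q1 E1] := smod1P n (k i)%:Z; have [q2 E2] := smod1P n (l i)%:Z.
have [q3 E3] := smod1P n ((k i + l i) %% N)%N%:Z.
have := divn_eq (k i + l i) N; move: (_ %/ _)%N E3 => q4 E3 E4.
exists (q1 + q2 - q3 - q4%:Z); rewrite !mulrBl mulrDl; lia.
Qed.

Lemma symrepN g : symrep (- g) = - symrep g.
Proof.
apply/rowP => i; rewrite [RHS]mxE.
have [q E] := symrepD g (- g) i; have Z : symrep (g - g) 0 i = 0.
  by rewrite subrr !mxE ffunE /= smod1_small//; lia.
have := smod1_bound n (g i)%:Z; have := smod1_bound n ((- g)%R i)%:Z.
move: E; rewrite Z !mxE => E b1 b2.
have : smod1 n (g i)%:Z + smod1 n ((- g)%R i)%:Z = (- q) * N%:Z.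
  by rewrite mulNr; lia.
by move=> /mulN_small; lia.
Qed.

Lemma smod_symrep g : smod n (symrep g) = symrep g.
Proof. by apply/rowP => i; rewrite !mxE smod1_small// smod1_bound. Qed.

Lemma symrep_inj : injective symrep.
Proof.
move=> g h E; apply/ffunP => i; apply: val_inj.
have := congr1 (fun v : 'rV_d => v 0 i) E; rewrite !mxE.
have [q1 E1] := smod1P n (g i)%:Z; have [q2 E2] := smod1P n (h i)%:Z => E3.
have : (g i)%:Z - (h i)%:Z = (q1 - q2) * N%:Z by rewrite mulrBl; lia.
by have := ltn_ord (g i); have := ltn_ord (h i) => ? ? /mulN_small /=; lia.
Qed.

Lemma indN_symrep k l m : indN (R := R) n (symrep l + symrep m - symrep k) = (l + m == k)%:R.
Proof.
rewrite /indN; congr (nat_of_bool _)%:R.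
apply/eqP/eqP => [E|<-].
  apply: symrep_inj; apply/rowP => i.
  have [q E1] := symrepD l m i.
  have := congr1 (fun v : 'rV_d => v 0 i) E; rewrite !mxE => E2.
  have [q3 E3] := smod1P n (smod1 n (l i)%:Z + smod1 n (m i)%:Z - smod1 n (k i)%:Z).
  move: E1; rewrite !mxE => E1.
  have := smod1_bound n (k i)%:Z; have := smod1_bound n ((l + m)%R i)%:Z => b1 b2.
  have : smod1 n ((l + m)%R i)%:Z - smod1 n (k i)%:Z = (q3 + q) * N%:Z.
    by move: E3; rewrite E2 add0r mulrDl => <-; rewrite E1; ring.
  by move=> /mulN_small; lia.
apply/rowP => i; have [q E1] := symrepD l m i; move: E1; rewrite !mxE => E1.
by apply: (@smod1_unique _ _ _ (- q)); rewrite ?mulNr; lia.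
Qed.

Lemma symrep0 : symrep 0 = 0.
Proof. by apply/rowP => i; rewrite !mxE ffunE /= smod1_small//; lia. Qed.

Hypothesis T_gt0 : 0 < T.

(** The mesh size 2T/N cancels T and leaves a power of an N-th root of unity, so the value is
    symmetric in mode and point and depends only on residues modulo N. *)
Lemma grid_charE l g : grid_char l g = zeta_exp n (\sum_i symrep l 0 i * symrep g 0 i).
Proof.
rewrite /grid_char /fourier /zeta_exp /cis.
suff -> : pi / T * dotp (map_mx (fun a : int => a%:~R) (symrep l)) (grid_point g) =
  2 * pi / N%:R * (\sum_i symrep l 0 i * symrep g 0 i)%:~R by [].
rewrite /grid_point dotpZr /dotp rmorph_sum /= !mulr_sumr; apply: eq_bigr => i _.
rewrite !mxE rmorphM /= /hstep; field.
by rewrite (gt_eqF T_gt0) andbT -natrM addrC natr1 pnatr_eq0.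
Qed.

Lemma grid_charC k g : grid_char k g = grid_char g k.
Proof. by rewrite !grid_charE; congr zeta_exp; apply: eq_bigr => i _; rewrite mulrC. Qed.

Lemma grid_charDl k l g : grid_char (k + l) g = grid_char k g * grid_char l g.
Proof.
rewrite !grid_charE -zeta_expD -big_split /= !zeta_exp_sum; apply: eq_bigr => i _.
have [q ->] := symrepD k l i.
by rewrite -mulrDl [in LHS]mulrDl zeta_expD [q * _ * _]mulrAC zeta_exp_mulN mulr1.
Qed.

Lemma grid_charDr k g h : grid_char k (g + h) = grid_char k g * grid_char k h.
Proof. by rewrite grid_charC grid_charDl !(grid_charC k). Qed.

Lemma grid_char0l g : grid_char 0 g = 1.
Proof. by rewrite grid_charE big1 ?zeta_exp0// => i _; rewrite symrep0 mxE mul0r. Qed.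

Lemma grid_char0r k : grid_char k 0 = 1.
Proof. by rewrite grid_charC grid_char0l. Qed.

Hypothesis n_gt0 : (0 < n)%N.

Lemma grid_char_sep k : k != 0 -> exists g, grid_char k g != 1.
Proof.
move=> k0.
have [i ki] : exists i, k i != 0.
  apply/existsP; apply: contraNT k0; rewrite negb_exists => /forallP H.
  by apply/eqP/ffunP => i; rewrite ffunE; apply/eqP; have := H i; rewrite negbK.
(* The unit vector along a coordinate where k is nonzero; its character value is the root of unity
   with exponent k_i, strictly between 0 and N. *)
exists [ffun j => inord (j == i)].
rewrite grid_charE (bigD1 i)//= big1 ?addr0.
  rewrite [symrep [ffun _ => _] 0 i]mxE ffunE eqxx /= inordK; last by lia.
  rewrite [smod1 n 1]smod1_small ?mulr1; last by lia.
  rewrite mxE; have [q E] := smod1P n (k i)%:Z.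
  have -> : smod1 n (k i)%:Z = (k i)%:Z + (- q) * N%:Z by rewrite mulNr; lia.
  rewrite zeta_expD zeta_exp_mulN mulr1; apply: zeta_exp_neq1; have := ltn_ord (k i).
  by move: ki; rewrite -val_eqE /= -lt0n; lia.
move=> j /negbTE ji; rewrite [X in _ * X]mxE ffunE ji inordK//.
by rewrite smod1_small ?mulr0//; lia.
Qed.

Lemma card_gridG : #|(G : finZmodType)| = ((2 * n).+1 ^ d)%N.
Proof. by rewrite card_ffun !card_ord. Qed.

End Grid.

(** * From the modes to the grid values *)

Section PhysicalSpace.
Local Open Scope complex_scope.
Context {R : realType}.
Variables (d n : nat) (rad T : R) (b : R -> R -> R).
Hypothesis n_gt0 : (0 < n)%N.
Hypothesis T_gt0 : 0 < T.
Local Notation N := (2 * n).+1.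
Local Notation G := (gridG d n).
Local Notation chi := (@grid_char R d n T).
Local Notation pos := (@grid_point R d n T).

Let chiDl := @grid_charDl R d n T T_gt0.
Let chiDr := @grid_charDr R d n T T_gt0.
Let chi0l := @grid_char0l R d n T T_gt0.
Let chi0r := @grid_char0r R d n T T_gt0.
Let chi_sep := @grid_char_sep R d n T T_gt0 n_gt0.
Let chiC := @grid_charC R d n T T_gt0.

(** Filter and exponential are both products over the coordinates, so the sum over the grid factors
    into one-dimensional kernels at the angles pi v_i / T. *)
Lemma jackson_kernel_ge0 (v : 'rV[R]_d) :
  0 <= \sum_(l : G) (@jackson R d n (symrep l))%:C * fourier T (symrep l) v.
Proof.
rewrite -(sum_gridK _ (fun k => (jackson n k)%:C * fourier T k v)).
rewrite /gridK big_image /=.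
pose F i (j : 'I_N) : R[i] := (@jackson1 R n (j%:Z - n%:Z))%:C *
  cis ((j%:Z - n%:Z)%:~R * (pi / T * v 0 i)).
rewrite (eq_bigr (fun a : {ffun 'I_d -> 'I_N} => \prod_i F i (a i))).
  rewrite -(bigA_distr_bigA F); apply: prodr_ge0 => i _.
  exact: jackson1_kernel_ge0.
move=> a _; rewrite /F big_split /=; congr (_ * _).
  rewrite /jackson rmorph_prod /=; apply: eq_bigr => i _.
  by rewrite mxE.
rewrite -cis_sum /fourier /cis; congr (cos _ +i* sin _);
  rewrite /dotp mulr_sumr; apply: eq_bigr => i _; rewrite !mxE; ring.
Qed.

Lemma fourierD (k : 'rV[int]_d) (x y : 'rV[R]_d) :
  fourier T k (x + y) = fourier T k x * fourier T k y.
Proof. by rewrite /fourier dotpDr mulrDr -/(cis _) cisD. Qed.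

Definition sigma_modes (l m : G) : R[i] :=
  kernel_mode_sigma n rad T b (symrep l) (symrep m).

Lemma jacksonN (k : 'rV[int]_d) : @jackson R d n (- k) = jackson n k.
Proof. by apply: eq_bigr => i _; rewrite mxE jackson1N. Qed.

Lemma sigma_modes_oppl l m : sigma_modes (- l) m = sigma_modes l m.
Proof.
rewrite /sigma_modes /kernel_mode_sigma /kernel_modeN !smod_symrep symrepN//.
by rewrite kernel_mode_oppl jacksonN.
Qed.

Lemma sigma_modes_oppr l m : sigma_modes l (- m) = sigma_modes l m.
Proof.
rewrite /sigma_modes /kernel_mode_sigma /kernel_modeN !smod_symrep symrepN//.
by rewrite kernel_mode_oppr jacksonN.
Qed.

Local Notation coeff := (collision_coeff chi sigma_modes).

Section Nonnegative.
Hypothesis b_ge0 : forall x c : R, 0 < x -> 0 <= c <= 1 -> 0 <= b x c.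
Hypothesis conv : modes_converge d rad T b.

Lemma coeff_ge0 p q : 0 <= coeff p q.
Proof.
rewrite /collision_coeff mulr_ge0//.
pose c (lm : G * G) : R[i] := (jackson n (symrep lm.1))%:C * (jackson n (symrep lm.2))%:C *
   (chi lm.1 (- p) * chi lm.2 (- q)).
rewrite pair_bigA /= (_ : \sum_lm _ = \sum_(lm : G * G)
    c lm * kernel_mode rad T b (symrep lm.1) (symrep lm.2)); last first.
  apply: eq_bigr => -[l m] _ /=.
  rewrite /sigma_modes /kernel_mode_sigma /kernel_modeN !smod_symrep /c /=.
  by move: (kernel_mode _ _ _ _ _) => u; ring.
apply: kernel_mode_lincomb_ge0 => // y z _ _.
(* A character at -p is the mode evaluated at a grid point, so it merges with the mode at y into a
   shifted argument, and the double sum becomes a product of two shifted Jackson kernels. *)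
have -> : \sum_(lm : G * G) c lm * (fourier T (symrep lm.1) y * fourier T (symrep lm.2) z) =
    (\sum_(l : G) (jackson n (symrep l))%:C * fourier T (symrep l) (y + pos (- p))) *
    (\sum_(m : G) (jackson n (symrep m))%:C * fourier T (symrep m) (z + pos (- q))).
  rewrite mulr_suml -(pair_bigA _ (fun l m => c (l, m) *
    (fourier T (symrep l) y * fourier T (symrep m) z))) /=.
  apply: eq_bigr => l _; rewrite mulr_sumr; apply: eq_bigr => m _.
  by rewrite /c /= !fourierD /grid_char; ring.
by rewrite mulr_ge0// jackson_kernel_ge0.
Qed.

End Nonnegative.

Variables (f0 : 'rV[R]_d -> R) (Fh : R -> 'rV[int]_d -> R[i]).

Lemma grid_value_grid_point (t : R) (g : G) : grid_value n T Fh (pos g) t =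
  \sum_k Fh t (symrep k) * chi k g.
Proof. by rewrite /grid_value (sum_gridK _ (fun k => Fh t k * fourier T k (pos g))). Qed.

Lemma is_derive_lincomb2 (f g : R -> R) (df dg x y t : R) :
  is_derive t (1 : R) f df -> is_derive t (1 : R) g dg ->
  is_derive t (1 : R) (fun s => f s * x + g s * y) (df * x + dg * y).
Proof.
move=> Hf Hg; rewrite (mulrC df) (mulrC dg).
under eq_fun do rewrite (mulrC (f _)) (mulrC (g _)).
exact: (is_deriveD (is_deriveZ x Hf) (is_deriveZ y Hg)).
Qed.

Lemma is_cderive_lincomb (I : Type) (s : seq I) (f : I -> R -> R[i])
    (w c : I -> R[i]) (t : R) : (forall i, is_cderive (f i) t (w i)) ->
  is_cderive (fun x => \sum_(i <- s) f i x * c i) t (\sum_(i <- s) w i * c i).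
Proof.
move=> H; have Hr i := (H i).1; have Hi i := (H i).2.
split; rewrite ?Re_sum ?Im_sum.
- under eq_fun do rewrite Re_sum.
  apply: is_derive_bigsum => i; rewrite Re_mul -mulrN.
  under eq_fun do rewrite Re_mul -mulrN.
  exact: is_derive_lincomb2.
- under eq_fun do rewrite Im_sum.
  apply: is_derive_bigsum => i; rewrite Im_mul.
  under eq_fun do rewrite Im_mul.
  exact: is_derive_lincomb2.
Qed.

Lemma ode_rhs_symrep (c : 'rV[int]_d -> R[i]) (k : G) :
  ode_rhs n rad T b c (symrep k) = \sum_(l : G) \sum_(m : G)
    (l + m == k)%:R * (sigma_modes l m - sigma_modes m m) * c (symrep l) * c (symrep m).
Proof.
rewrite /ode_rhs sum_gridK; apply: eq_bigr => l _.
by rewrite sum_gridK; apply: eq_bigr => m _; rewrite indN_symrep.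
Qed.

Lemma is_cderive_grid_value (t : R) (g : G) :
  (forall k, k \in gridK d n ->
     is_cderive (fun s => Fh s k) t (ode_rhs n rad T b (Fh t) k)) ->
  is_cderive (grid_value n T Fh (pos g)) t
    (collision coeff (fun j => grid_value n T Fh (pos j) t)
       (fun j => grid_value n T Fh (pos j) t) g).
Proof.
move=> H.
have := is_cderive_lincomb (index_enum G) (fun k => chi k g)
  (fun k : G => H _ (symrep_gridK k)).
under eq_fun do rewrite -grid_value_grid_point.
rewrite (eq_bigr _ (fun k _ => congr1 (fun w => w * chi k g) (ode_rhs_symrep (Fh t) k))).
rewrite (collision_fourier chiDl chiDr chi0l chi0r chi_sep sigma_modes (fun k => Fh t (symrep k))).
rewrite (_ : (fun j => \sum_k Fh t (symrep k) * chi k j) =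
  fun j => grid_value n T Fh (pos j) t)//.
by apply/funext => j; rewrite grid_value_grid_point.
Qed.

(** The initial modes are discrete Fourier coefficients, so inversion recovers [f0] at the grid
    points; the initial grid values are thus real and inherit the sign of [f0]. *)
Lemma grid_value_initial (g : G) :
  (forall k, k \in gridK d n -> Fh 0 k = initial_modes n T f0 k) ->
  grid_value n T Fh (pos g) 0 = (f0 (pos g))%:C.
Proof.
move=> H; rewrite grid_value_grid_point.
rewrite -[RHS](fourier_inversion chiDl chiDr chi0l chi0r chi_sep chiC
  (fun j => (f0 (pos j))%:C) g).
apply: eq_bigr => k _; congr (_ * _).
rewrite H ?symrep_gridK// /initial_modes card_gridG; congr (_ * _).
rewrite sum_gridX; apply: eq_bigr => j _; congr (_ * _).
by rewrite /grid_char symrepN.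
Qed.

End PhysicalSpace.

Lemma collision_complex (R : realType) (G : finZmodType) (A : G -> G -> R)
    (C : G -> G -> R[i]) (F : G -> R[i]) (g : G)
    (u := fun j => complex.Re (F j)) (v := fun j => complex.Im (F j)) :
  (forall p q, C p q = Complex (A p q) 0) ->
  collision C F F g =
    Complex (collision A u u g - collision A v v g) (collision A u v g + collision A v u g).
Proof.
move=> CA; apply/eqP; rewrite eq_complex /collision /=; apply/andP; split; apply/eqP.
- rewrite Re_sum -sumrB; apply: eq_bigr => p _.
  rewrite Re_sum -sumrB; apply: eq_bigr => q _.
  rewrite CA Re_mul /= /u /v; case: (F (g + p)) (F (g + q)) (F g) (F (g + p + q)).
  by move=> ? ? [? ?] [? ?] [? ?] /=; ring.
- rewrite Im_sum -big_split; apply: eq_bigr => p _ /=.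
  rewrite Im_sum -big_split; apply: eq_bigr => q _ /=.
  rewrite CA Im_mul /= /u /v; case: (F (g + p)) (F (g + q)) (F g) (F (g + p + q)).
  by move=> ? ? [? ?] [? ?] [? ?] /=; ring.
Qed.

(** Bridges the notion of solution, right continuous at 0 and differentiable at later times, and the
    Gronwall lemmas, which need continuity on a closed interval. The derivative at [b] itself gives
    continuity at the right end. *)
Lemma within_continuous_ivp (R : realType) (f df : R -> R) (b : R) : 0 < b ->
  f x @[x --> 0^'+] --> f 0 ->
  (forall t, 0 < t -> t <= b -> is_derive t (1 : R) f (df t)) ->
  {within `[0, b], continuous f}.
Proof.
move=> b0 f0 fd.
have cf t : 0 < t -> t <= b -> {for t, continuous f}.
  move=> t0 tb; apply: differentiable_continuous.
  by apply/derivable1_diffP; have [] := fd t t0 tb.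
apply/continuous_within_itvP => //; split => //.
- by move=> t; rewrite in_itv /= => /andP[t0 /ltW tb]; exact: cf.
- by apply: cvg_at_left_filter; exact: cf.
Qed.

Lemma right_continuous_lincomb (R : realType) (I : Type) (s : seq I)
    (f : I -> R -> R[i]) (c : I -> R[i]) (t : R) :
  (forall i, right_continuous_at (f i) t) ->
  right_continuous_at (fun x => \sum_(i <- s) f i x * c i) t.
Proof.
move=> H; split.
- under eq_fun do rewrite Re_sum; rewrite Re_sum.
  apply: cvg_big => [|i _]; first exact: add_continuous.
  under eq_fun do rewrite Re_mul; rewrite Re_mul.
  by have [Hr Hi] := H i; apply: cvgB; apply: cvgMr_tmp.
- under eq_fun do rewrite Im_sum; rewrite Im_sum.
  apply: cvg_big => [|i _]; first exact: add_continuous.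
  under eq_fun do rewrite Im_mul; rewrite Im_mul.
  by have [Hr Hi] := H i; apply: cvgD; apply: cvgMr_tmp.
Qed.

Theorem theorem2p1 (R : realType) (d n : nat) (rad T : R)
    (b : R -> R -> R) (f0 : 'rV[R]_d -> R)
    (tau : \bar R) (Fh : R -> 'rV[int]_d -> R[i]) :
  (2 <= d)%N -> (1 <= n)%N -> 0 < rad ->
  (3 * Num.sqrt 2 + 1) / 4 * rad <= T ->
  (forall x c : R, 0 < x -> 0 <= c <= 1 -> 0 <= b x c) ->
  modes_converge d rad T b ->
  (forall v, 0 <= f0 v) ->
  (0 < tau)%E ->
  entropic_solution n rad T b f0 tau Fh ->
  forall t : R, 0 < t -> (t%:E < tau)%E ->
  [/\ is_cderive (fun s => \sum_(r <- gridX d n T) grid_value n T Fh r s) t 0,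
      (forall r, r \in gridX d n T -> 0 <= grid_value n T Fh r t) &
      let H s := \sum_(r <- gridX d n T)
        complex.Re (grid_value n T Fh r s) *
        ln (complex.Re (grid_value n T Fh r s)) in
      derivable H t 1 /\ 'D_1 H t <= 0].
Proof.
move=> _ n_gt0 rad_gt0 radT b_ge0 conv f0_ge0 _ sol t t_gt0 t_tau.
have T_gt0 : 0 < T.
  by apply: lt_le_trans radT; rewrite mulr_gt0.
(* The gap between t and B makes t an interior time, and the gap between B and [tau] keeps the
   equation valid at B. *)
have [B tB B_tau] : exists2 B : R, t < B & (B%:E < tau)%E.
  case: tau t_tau {sol} => [c| |//]; last by exists (t + 1); [lra|exact: ltry].
  by rewrite lte_fin => tc; exists ((t + c) / 2); rewrite ?lte_fin; lra.
have B_gt0 : 0 < B by apply: lt_trans tB.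
pose C := collision_coeff (@grid_char R d n T) (@sigma_modes R d n rad T b).
pose A p q := complex.Re (C p q).
have C_ge0 p q : 0 <= C p q by exact: coeff_ge0.
(* Nonnegativity in [R[i]] includes being real, so no separate argument for the reality of the
   coefficients is needed. *)
have CA p q : C p q = Complex (A p q) 0.
  have := C_ge0 p q; rewrite lec0_ReIm /A; case: (C p q) => x y /= /andP[/eqP -> _] //.
have A_ge0 p q : 0 <= A p q.
  by have := C_ge0 p q; rewrite lec0_ReIm => /andP[].
have CNl p q : C (- p) q = C p q.
  apply: collision_coeff_oppl; [exact: grid_charDl|exact: grid_charDr|exact: grid_char0l|exact: grid_char0r|].
  exact: sigma_modes_oppl.
have CNr p q : C p (- q) = C p q.
  apply: collision_coeff_oppr; [exact: grid_charDl|exact: grid_charDr|exact: grid_char0l|exact: grid_char0r|].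
  exact: sigma_modes_oppr.
have ANl p q : A (- p) q = A p q by rewrite /A CNl.
have ANr p q : A p (- q) = A p q by rewrite /A CNr.
pose F (g : gridG d n) (s : R) := grid_value n T Fh (@grid_point R d n T g) s.
have dF g s : 0 < s -> s <= B -> is_cderive (F g) s (collision C (F^~ s) (F^~ s) g).
  move=> s_gt0 sB; apply: is_cderive_grid_value => // k kK.
  have [_ _] := sol k kK; apply => //.
  by apply: le_lt_trans B_tau; rewrite lee_fin.
pose u g s := complex.Re (F g s); pose v g s := complex.Im (F g s).
have du g s : 0 < s -> s <= B -> is_derive s (1 : R) (u g)
    (collision A (u^~ s) (u^~ s) g - collision A (v^~ s) (v^~ s) g).
  by move=> s_gt0 sB; have [+ _] := dF g s s_gt0 sB; rewrite (collision_complex _ _ CA).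
have dv g s : 0 < s -> s <= B -> is_derive s (1 : R) (v g)
    (collision A (u^~ s) (v^~ s) g + collision A (v^~ s) (u^~ s) g).
  by move=> s_gt0 sB; have [_] := dF g s s_gt0 sB; rewrite (collision_complex _ _ CA).
have F0 g : F g 0 = Complex (f0 (grid_point T g)) 0.
  by apply: grid_value_initial => // k kK; have [] := sol k kK.
have [ru rv] : (forall g, u g s @[s --> 0^'+] --> u g 0) /\
    (forall g, v g s @[s --> 0^'+] --> v g 0).
  have rF g : right_continuous_at (F g) 0.
    have -> : F g = fun s => \sum_k Fh s (symrep k) * grid_char T k g.
      by apply/funext => s; rewrite /F grid_value_grid_point.
    apply: right_continuous_lincomb => k.
    by have [] := sol (symrep k) (symrep_gridK k).
  by split=> g; have [] := rF g.
have cu g := within_continuous_ivp B_gt0 (ru g) (du g).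
have cv g := within_continuous_ivp B_gt0 (rv g) (dv g).
have itvP s : s \in `]0, B[ -> 0 < s /\ s <= B.
  by rewrite in_itv /= => /andP[-> /ltW].
have du' g s (sB : s \in `]0, B[) := du g s (itvP s sB).1 (itvP s sB).2.
have dv' g s (sB : s \in `]0, B[) := dv g s (itvP s sB).1 (itvP s sB).2.
have u0 g : 0 <= u g 0 by rewrite /u F0 /=.
have v0 g : v g 0 = 0 by rewrite /v F0.
have tb : t \in `]0, B[ by rewrite in_itv /= t_gt0.
have tb' : t \in `[0, B] by apply: subset_itv_oo_cc.
split.
- have -> : (fun s => \sum_(r <- gridX d n T) grid_value n T Fh r s) =
     (fun s => \sum_g F g s * 1).
    apply/funext => s; rewrite (sum_gridX n T (fun r => grid_value n T Fh r s)).
    by apply: eq_bigr => g _; rewrite mulr1.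
  have := is_cderive_lincomb (index_enum _) (fun=> 1)
    (fun g => dF g t t_gt0 (ltW tB)).
  (* Mass is conserved by the evenness of the complex coefficients alone, directly for the complex
     grid values. *)
  by under eq_bigr do rewrite mulr1; rewrite (sum_collision CNl CNr).
- move=> r /gridX_grid_point[g ->]; rewrite lec0_ReIm -/(F g t) -/(u g t) -/(v g t).
  rewrite (imaginary_part_eq0 A_ge0 B_gt0 cu cv dv' v0)// eqxx /=.
  exact: (density_ge0 A_ge0 B_gt0 cu cv du' dv').
- have -> : (fun s => \sum_(r <- gridX d n T)
      complex.Re (grid_value n T Fh r s) *
      ln (complex.Re (grid_value n T Fh r s))) =
      (fun s => \sum_g u g s * ln (u g s)).
    apply/funext => s.
    by rewrite (sum_gridX n T (fun r => complex.Re (grid_value n T Fh r s) *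
      ln (complex.Re (grid_value n T Fh r s)))).
  exact: (discrete_entropy_decreasing A_ge0 ANl ANr B_gt0 cu cv du' dv').
Qed.
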